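(* Let $n>3$ and let $p$ be a permutation pattern. If $p$ is not periodic for $3$, then $p$ is not periodic for $n$.
   Context: An affine permutation of size $n$ is a bijection $w:\mathbb{Z}\to\mathbb{Z}$ with $w(i+n)=w(i)+n$ for all $i$ and $w(1)+\cdots+w(n)=\binom{n+1}{2}$; $\widetilde{S}_n$ is the group of these, generated by $s_0,\dots,s_{n-1}$ where $ws_i$ swaps the values at positions $i+mn$ and $i+1+mn$ for all $m$; $\ell(w)$ is the minimal number of generators in a factorization. $w$ contains $p\in S_k$ if there exist integers $i_1<\cdots<i_k$ with $w(i_1),\dots,w(i_k)$ in the same relative order as $p_1,\dots,p_k$, otherwise avoids $p$. With $F_{p,n}(x)=\sum_{w\in\widetilde{S}_n,\,w\text{ avoids }p}x^{\ell(w)}=\sum_ia_ix^i$, $p$ is periodic for $n$ if there exist $N\ge1$ and $i_0$ with $a_i=a_{i-N}$ for all $i\ge i_0$. *)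

(* Defs.v *)
From Stdlib Require Import ZArith List Lia Permutation.
Import ListNotations.
Open Scope Z_scope.

Definition affine_perm (n : nat) (w : Z -> Z) : Prop :=
  (forall x y, w x = w y -> x = y) /\ (forall y, exists x, w x = y) /\
  (forall i, w (i + Z.of_nat n) = w i + Z.of_nat n) /\
  fold_right Z.add 0 (map (fun i => w (Z.of_nat i)) (seq 1 n))
    = Z.of_nat n * (Z.of_nat n + 1) / 2.

Definition gen (n : nat) (j : nat) (x : Z) : Z :=
  if Z.eqb ((x - Z.of_nat j) mod Z.of_nat n) 0 then x + 1
  else if Z.eqb ((x - Z.of_nat j - 1) mod Z.of_nat n) 0 then x - 1
  else x.

(* product s_{j1} s_{j2} ... s_{jk}; right multiplication w s_i = w o s_i *)
Definition word_fun (n : nat) (js : list nat) : Z -> Z :=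
  fold_right (fun j f => fun x => gen n j (f x)) (fun x => x) js.

Definition is_factorization (n : nat) (w : Z -> Z) (js : list nat) : Prop :=
  Forall (fun j => (j < n)%nat) js /\ forall x, w x = word_fun n js x.

Definition has_length (n : nat) (w : Z -> Z) (k : nat) : Prop :=
  (exists js, length js = k /\ is_factorization n w js) /\
  (forall js, is_factorization n w js -> (k <= length js)%nat).

(* p is a permutation in S_k, written in one-line notation p_1 ... p_k *)
Definition is_perm_pattern (p : list nat) : Prop :=
  Permutation p (seq 1 (length p)).

Definition contains (w : Z -> Z) (p : list nat) : Prop :=
  exists idx : list Z, length idx = length p /\
    (forall a b, (a < b < length p)%nat -> nth a idx 0 < nth b idx 0) /\
    (forall a b, (a < length p)%nat -> (b < length p)%nat ->
       (w (nth a idx 0) < w (nth b idx 0) <-> (nth a p 0 < nth b p 0)%nat)).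

Definition avoids (w : Z -> Z) (p : list nat) : Prop := ~ contains w p.

(* an affine permutation is determined by its window [w(1),...,w(n)] *)
Definition window (n : nat) (w : Z -> Z) : list Z :=
  map (fun i => w (Z.of_nat i)) (seq 1 n).

(* coeff n p i c : the coefficient a_i of x^i in F_{p,n}(x) equals c *)
Definition coeff (n : nat) (p : list nat) (i c : nat) : Prop :=
  exists l : list (list Z), NoDup l /\ length l = c /\
    forall v, In v l <->
      exists w, affine_perm n w /\ avoids w p /\ has_length n w i /\ v = window n w.

Definition periodic (p : list nat) (n : nat) : Prop :=
  exists N i0 : nat, (1 <= N)%nat /\
    forall i, (i0 <= i)%nat -> forall c, coeff n p (i + N) c <-> coeff n p i c.

(* Main.v *)
(** Write an element of the affine group of size [3] as a choice of residues together
    with a point [(u, v)] of the plane: its window is [3 u + s0, 3 v + s1,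
    3 (-u-v) + s2].  For fixed residues an occurrence of [p] is an integer solution of
    a system of difference constraints whose bounds are affine in [(u, v)];
    eliminating the unknowns shows that the avoiders form a Boolean combination of
    half-planes.  Such a set either lies on finitely many lines or contains the far
    part of an open cone.  If every residue class is of the first kind, the
    avoiders are finitely many rays along which the length (Shi's formula) is
    eventually affine, so [p] is periodic for [3].  Otherwise every [q] in the cone
    yields an element [Wn n q] of size [n], made of three lines of slope one, all of
    whose patterns occur in the element of size [3] with parameter [3 n^2 q].  The
    length of [Wn n q] is linear on the cone, so arbitrarily many avoiders of size
    [n] share the same length, whereas periodicity bounds the coefficients. *)
Require Import Defs.
From Stdlib Require Import ZArith List Lia Classical.
Import ListNotations.
Open Scope Z_scope.

(** * Shi's length formula *)

Fixpoint sumZ (f : nat -> Z) (n : nat) : Z :=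
  match n with O => 0 | S k => sumZ f k + f k end.

Lemma sumZ_last f n : sumZ f (S n) = sumZ f n + f n.
Proof. reflexivity. Qed.

Lemma sumZ_ext f g n :
  (forall i, (i < n)%nat -> f i = g i) -> sumZ f n = sumZ g n.
Proof.
  induction n as [|n IH]; intros H; simpl; [reflexivity|].
  rewrite IH, H; auto; lia.
Qed.

Lemma sumZ_head f n : sumZ f (S n) = f O + sumZ (fun i => f (S i)) n.
Proof. induction n as [|n IH]; [simpl; lia|]. simpl in *. lia. Qed.

Lemma sumZ_const c n : sumZ (fun _ => c) n = Z.of_nat n * c.
Proof. induction n as [|n IH]; [reflexivity|]. rewrite sumZ_last, IH. lia. Qed.

Lemma sumZ_seq (f : nat -> Z) n s :
  fold_right Z.add 0 (map f (seq s n)) = sumZ (fun i => f (s + i)%nat) n.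
Proof.
  revert s; induction n as [|n IH]; intros s; [reflexivity|].
  rewrite sumZ_head. simpl. rewrite IH. rewrite Nat.add_0_r. f_equal.
  apply sumZ_ext. intros. f_equal. lia.
Qed.

Definition pairsum (g : nat -> nat -> Z) (n : nat) : Z :=
  sumZ (fun j => sumZ (fun i => g i j) j) n.

Lemma pairsum_ext f g n :
  (forall i j, (i < j < n)%nat -> f i j = g i j) -> pairsum f n = pairsum g n.
Proof.
  intros H. apply sumZ_ext. intros j Hj. apply sumZ_ext. intros i Hi. apply H. lia.
Qed.

Lemma pairsum_last g n : pairsum g (S n) = pairsum g n + sumZ (fun i => g i n) n.
Proof. reflexivity. Qed.

Lemma pairsum_head g n :
  pairsum g (S n) =
  sumZ (fun j => g O (S j)) n + pairsum (fun i j => g (S i) (S j)) n.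
Proof.
  induction n as [|n IH]; [reflexivity|].
  rewrite pairsum_last, IH, pairsum_last, sumZ_head. simpl. lia.
Qed.

Lemma sumZ_nonneg f n : (forall i, 0 <= f i) -> 0 <= sumZ f n.
Proof. intros H; induction n as [|n IH]; simpl; [lia|]. specialize (H n). lia. Qed.

Lemma pairsum_nonneg g n : (forall i j, 0 <= g i j) -> 0 <= pairsum g n.
Proof. intros H. apply sumZ_nonneg. intros. apply sumZ_nonneg. auto. Qed.

(** * Shift invariance and the normalization of affine permutations *)

Lemma shift_invariant {T} (F : Z -> T) :
  (forall a, F (a + 1) = F a) -> forall a b, F a = F b.
Proof.
  intros H.
  assert (H1 : forall (k : nat) a, F (a + Z.of_nat k) = F a).
  { induction k as [|k IH]; intros a; [f_equal; lia|].
    replace (a + Z.of_nat (S k)) with (a + Z.of_nat k + 1) by lia.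
    rewrite H. apply IH. }
  intros a b. destruct (Z_le_gt_dec a b).
  - rewrite <- (H1 (Z.to_nat (b - a)) a). f_equal. lia.
  - rewrite <- (H1 (Z.to_nat (a - b)) b). f_equal. lia.
Qed.

Lemma affine_shift (n : nat) (w : Z -> Z) :
  (forall i, w (i + Z.of_nat n) = w i + Z.of_nat n) ->
  forall k x, w (x + k * Z.of_nat n) = w x + k * Z.of_nat n.
Proof.
  intros H k x.
  assert (E := shift_invariant
    (fun k => w (x + k * Z.of_nat n) - k * Z.of_nat n)).
  simpl in E. specialize (fun H => E H k 0). cbv beta in E.
  rewrite Z.mul_0_l, Z.add_0_r in E.
  cut (w (x + k * Z.of_nat n) - k * Z.of_nat n = w x - 0); [lia|].
  apply E. intros a.
  replace (x + (a + 1) * Z.of_nat n) with (x + a * Z.of_nat n + Z.of_nat n) by lia.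
  rewrite H. lia.
Qed.

(** A difference [k n] of values would, by periodicity and injectivity, force [j = i + k n]; so two
    positions in one window never have values congruent modulo [n]. *)
Lemma affine_nondiv (n : nat) (w : Z -> Z) i j k :
  affine_perm n w -> 0 < j - i < Z.of_nat n -> w j - w i <> k * Z.of_nat n.
Proof.
  intros (Hi & _ & Hp & _) Hij E.
  assert (j = i + k * Z.of_nat n).
  { apply Hi. rewrite (affine_shift n w Hp). lia. }
  assert (0 < k) by nia. nia.
Qed.

(** The normalization of the window sum amounts to [displ w n 1 = 0]. Unlike a sum of values, this
    total displacement is, for periodic [w], the same for every starting point [a]. *)
Definition displ (w : Z -> Z) (n : nat) (a : Z) : Z :=
  sumZ (fun i => w (a + Z.of_nat i) - (a + Z.of_nat i)) n.

Lemma displ_shift (n : nat) (w : Z -> Z) a b :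
  (forall i, w (i + Z.of_nat n) = w i + Z.of_nat n) -> displ w n a = displ w n b.
Proof.
  intros H. apply shift_invariant. clear a b. intros a. unfold displ.
  destruct n as [|k]; [reflexivity|].
  rewrite (sumZ_head (fun i => w (a + Z.of_nat i) - (a + Z.of_nat i))).
  rewrite sumZ_last.
  replace (a + 1 + Z.of_nat k) with (a + Z.of_nat (S k)) by lia. rewrite H.
  rewrite (sumZ_ext _ (fun i : nat => w (a + Z.of_nat (S i)) - (a + Z.of_nat (S i)))).
  - replace (a + Z.of_nat 0) with a by lia. lia.
  - intros i _. replace (a + 1 + Z.of_nat i) with (a + Z.of_nat (S i)) by lia. lia.
Qed.

Lemma window_sum_displ (n : nat) (w : Z -> Z) :
  fold_right Z.add 0 (map (fun i => w (Z.of_nat i)) (seq 1 n))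
  = displ w n 1 + Z.of_nat n * (Z.of_nat n + 1) / 2.
Proof.
  rewrite sumZ_seq.
  assert (H : forall m : nat, 2 * sumZ (fun i => 1 + Z.of_nat i) m
                      = Z.of_nat m * (Z.of_nat m + 1)).
  { induction m as [|m IH]; [reflexivity|].
    rewrite sumZ_last, Z.mul_add_distr_l, IH. lia. }
  rewrite <- H, (Z.mul_comm 2), Z.div_mul by lia. unfold displ. clear H.
  induction n as [|n IH]; [reflexivity|]. rewrite !sumZ_last, IH.
  replace (Z.of_nat (1 + n)) with (1 + Z.of_nat n) by lia. lia.
Qed.

Lemma affine_permE (n : nat) (w : Z -> Z) :
  affine_perm n w <->
  (forall x y, w x = w y -> x = y) /\ (forall y, exists x, w x = y) /\
  (forall i, w (i + Z.of_nat n) = w i + Z.of_nat n) /\ displ w n 1 = 0.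
Proof.
  unfold affine_perm. rewrite window_sum_displ.
  split; intros (? & ? & ? & ?); repeat split; auto; lia.
Qed.

(** * Action of the generators *)

Lemma gen_at (n j : nat) (k i : Z) : (2 <= n)%nat ->
  let a := Z.of_nat j + k * Z.of_nat n in
  gen n j a = a + 1 /\ gen n j (a + 1) = a /\
  (2 <= i < Z.of_nat n -> gen n j (a + i) = a + i).
Proof.
  intros Hn a. unfold gen, a.
  assert (E : forall r, 0 <= r < Z.of_nat n -> forall z, z = r + k * Z.of_nat n ->
    z mod Z.of_nat n = r).
  { intros r Hr z ->. rewrite Z.mod_add by lia. apply Z.mod_small. lia. }
  repeat split.
  - rewrite (E 0); [reflexivity|lia|lia].
  - rewrite (E 1); [|lia|lia]. rewrite (E 0); [|lia|lia]. simpl. lia.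
  - intros Hi. rewrite (E i); [|lia|lia]. rewrite (E (i - 1)); [|lia|lia].
    destruct (Z.eqb_spec i 0); [lia|]. destruct (Z.eqb_spec (i - 1) 0); lia.
Qed.

Lemma residue_decomp (n : nat) (j x : Z) : (1 <= n)%nat ->
  exists k i, x = j + k * Z.of_nat n + i /\ 0 <= i < Z.of_nat n.
Proof.
  intros Hn. exists ((x - j) / Z.of_nat n), ((x - j) mod Z.of_nat n).
  pose proof (Z.div_mod (x - j) (Z.of_nat n) ltac:(lia)).
  pose proof (Z.mod_pos_bound (x - j) (Z.of_nat n) ltac:(lia)). lia.
Qed.

Lemma gen_involutive (n j : nat) x : (2 <= n)%nat -> gen n j (gen n j x) = x.
Proof.
  intros Hn. destruct (residue_decomp n (Z.of_nat j) x) as (k & i & -> & Hi); [lia|].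
  destruct (gen_at n j k i Hn) as (H0 & H1 & H2).
  destruct (Z.eq_dec i 0) as [->|]; [rewrite Z.add_0_r; congruence|].
  destruct (Z.eq_dec i 1) as [->|]; [congruence|].
  rewrite H2, H2 by lia. reflexivity.
Qed.

Lemma gen_shift (n j : nat) x : (2 <= n)%nat ->
  gen n j (x + Z.of_nat n) = gen n j x + Z.of_nat n.
Proof.
  intros Hn. destruct (residue_decomp n (Z.of_nat j) x) as (k & i & -> & Hi); [lia|].
  destruct (gen_at n j k i Hn) as (H0 & H1 & H2).
  destruct (gen_at n j (k + 1) i Hn) as (H0' & H1' & H2').
  replace (Z.of_nat j + k * Z.of_nat n + i + Z.of_nat n)
    with (Z.of_nat j + (k + 1) * Z.of_nat n + i) by lia.
  destruct (Z.eq_dec i 0) as [->|]; [rewrite !Z.add_0_r, H0, H0'; lia|].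
  destruct (Z.eq_dec i 1) as [->|]; [rewrite H1, H1'; lia|].
  rewrite H2, H2' by lia. lia.
Qed.

Lemma affine_perm_comp_gen (n j : nat) w : (2 <= n)%nat ->
  affine_perm n w -> affine_perm n (fun x => w (gen n j x)).
Proof.
  intros Hn. rewrite !affine_permE. intros (Hi & Hs & Hp & Hd).
  assert (Hp' : forall i, w (gen n j (i + Z.of_nat n)) = w (gen n j i) + Z.of_nat n).
  { intros i. rewrite gen_shift by lia. apply Hp. }
  repeat split; auto.
  - intros x y E. apply Hi in E.
    rewrite <- (gen_involutive n j x), E by lia. apply gen_involutive; lia.
  - intros y. destruct (Hs y) as [x Hx]. exists (gen n j x).
    rewrite gen_involutive by lia. exact Hx.
  (* With the window started at [j], the exchanged positions are its first two entries, so the sum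
     visibly stays the same. *)
  - rewrite (displ_shift n _ 1 (Z.of_nat j) Hp').
    rewrite (displ_shift n _ 1 (Z.of_nat j) Hp) in Hd. rewrite <- Hd. unfold displ.
    destruct n as [|[|m]]; [lia|lia|]. rewrite !sumZ_head.
    destruct (gen_at (S (S m)) j 0 0 Hn) as (H0 & H1 & _).
    rewrite Z.mul_0_l, Z.add_0_r in H0, H1.
    rewrite (sumZ_ext
      (fun i => w (gen (S (S m)) j (Z.of_nat j + Z.of_nat (S (S i)))) - _)
      (fun i => w (Z.of_nat j + Z.of_nat (S (S i))) - (Z.of_nat j + Z.of_nat (S (S i))))).
    + change (Z.of_nat 0) with 0; change (Z.of_nat 1) with 1.
      rewrite !Z.add_0_r, H0, H1. lia.
    + intros i Hlt.
      destruct (gen_at (S (S m)) j 0 (Z.of_nat (S (S i))) Hn) as (_ & _ & H2).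
      rewrite Z.mul_0_l, Z.add_0_r in H2. rewrite H2 by lia. reflexivity.
Qed.

(** Shi's formula for the length, read off the window that starts at [a] instead of 1. *)
Definition shi_inv (n : nat) (w : Z -> Z) (a : Z) : Z :=
  pairsum (fun i j =>
    Z.abs ((w (a + Z.of_nat j) - w (a + Z.of_nat i)) / Z.of_nat n)) n.

Lemma div_opp_nondiv (n z : Z) : 0 < n -> (forall k, z <> k * n) ->
  (- z) / n = - (z / n) - 1.
Proof.
  intros Hn H. specialize (H (z / n)).
  pose proof (Z.div_mod z n ltac:(lia)).
  pose proof (Z.mod_pos_bound z n Hn).
  symmetry. apply (Z.div_unique _ _ _ (n - z mod n)); lia.
Qed.

(** Moving the window by one trades the pairs of [a] with [a + i] for pairs of [a + i] with [a + n].
    A difference [z] becomes [n - z], whose floor quotient is [-(z / n)] because [n] does not divide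
    [z]. *)
Lemma shi_inv_shift (n : nat) w a b : (1 <= n)%nat -> affine_perm n w ->
  shi_inv n w a = shi_inv n w b.
Proof.
  intros Hn Hw. apply shift_invariant. clear a b. intros a. unfold shi_inv.
  destruct n as [|k]; [lia|].
  rewrite pairsum_last, pairsum_head, Z.add_comm.
  f_equal.
  - apply sumZ_ext. intros i Hi.
    set (N := Z.of_nat (S k)) in *.
    replace (a + 1 + Z.of_nat k) with (a + N) by (unfold N; lia).
    replace (a + Z.of_nat 0) with a by lia.
    replace (a + 1 + Z.of_nat i) with (a + Z.of_nat (S i)) by lia.
    assert (Hp := proj1 (proj2 (proj2 Hw)) a). fold N in Hp. rewrite Hp.
    set (z := w (a + Z.of_nat (S i)) - w a).
    replace (w a + N - w (a + Z.of_nat (S i))) with (- z + 1 * N)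
      by (unfold z; lia).
    rewrite Z.div_add by (unfold N; lia).
    rewrite div_opp_nondiv; [lia|unfold N; lia|].
    intros q. apply (affine_nondiv (S k) w); [assumption|lia].
  - apply pairsum_ext. intros i j _.
    replace (a + 1 + Z.of_nat j) with (a + Z.of_nat (S j)) by lia.
    replace (a + 1 + Z.of_nat i) with (a + Z.of_nat (S i)) by lia. reflexivity.
Qed.

(* Starting the window at [a] makes [s_j] the exchange of its first two entries. *)
Lemma shi_inv_comp_gen (n j : nat) w k : (2 <= n)%nat -> affine_perm n w ->
  let a := Z.of_nat j + k * Z.of_nat n in
  shi_inv n (fun x => w (gen n j x)) a =
  shi_inv n w a + (if w a <? w (a + 1) then 1 else -1).
Proof.
  intros Hn Hw a.
  destruct (gen_at n j k 0 Hn) as (H0 & H1 & _). fold a in H0, H1.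
  assert (H2 : forall i : nat, (2 <= i < n)%nat ->
    gen n j (a + Z.of_nat i) = a + Z.of_nat i).
  { intros i Hi. apply (gen_at n j k (Z.of_nat i) Hn). lia. }
  assert (Hnd := fun q => affine_nondiv n w a (a + 1) q Hw ltac:(lia)).
  unfold shi_inv. destruct n as [|[|m]]; [lia|lia|].
  rewrite !pairsum_head, !sumZ_head.
  set (N := Z.of_nat (S (S m))) in *.
  change (Z.of_nat 0) with 0; change (Z.of_nat 1) with 1.
  rewrite !Z.add_0_r, H0, H1.
  rewrite (pairsum_ext
    (fun i j0 => Z.abs ((w (gen _ _ (a + Z.of_nat (S (S j0)))) - _) / N))
    (fun i j0 => Z.abs ((w (a + Z.of_nat (S (S j0))) -
                         w (a + Z.of_nat (S (S i)))) / N)))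
    by (intros i j0 Hij; rewrite !H2 by lia; reflexivity).
  rewrite (sumZ_ext (fun i => Z.abs ((w (gen _ _ _) - w a) / N))
    (fun i => Z.abs ((w (a + Z.of_nat (S (S i))) - w a) / N)))
    by (intros i Hi; rewrite !H2 by lia; reflexivity).
  rewrite (sumZ_ext (fun i => Z.abs ((w (gen _ _ _) - w (a + 1)) / N))
    (fun i => Z.abs ((w (a + Z.of_nat (S (S i))) - w (a + 1)) / N)))
    by (intros i Hi; rewrite !H2 by lia; reflexivity).
  replace (w a - w (a + 1)) with (- (w (a + 1) - w a)) by lia.
  rewrite div_opp_nondiv; [|unfold N; lia|exact Hnd].
  set (d := w (a + 1) - w a) in *.
  specialize (Hnd 0).
  assert (HN : 0 < N) by (unfold N; lia).
  pose proof (Z.div_mod d N ltac:(lia)). pose proof (Z.mod_pos_bound d N HN).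
  (* The exchange turns [|d / N|] into [|d / N + 1|]: one more when [d > 0], one less when
     [d < 0]. *)
  destruct (Z.ltb_spec (w a) (w (a + 1))).
  - assert (0 <= d / N) by (apply Z.div_pos; lia). lia.
  - assert (d / N < 0) by (apply Z.div_lt_upper_bound; lia). lia.
Qed.

Definition shi_length (n : nat) (w : Z -> Z) : Z := shi_inv n w 1.

Lemma shi_length_comp_gen (n j : nat) w k : (2 <= n)%nat -> affine_perm n w ->
  let a := Z.of_nat j + k * Z.of_nat n in
  shi_length n (fun x => w (gen n j x)) =
  shi_length n w + (if w a <? w (a + 1) then 1 else -1).
Proof.
  intros Hn Hw a. unfold shi_length.
  rewrite (shi_inv_shift n w 1 a) by (auto; lia).
  rewrite (shi_inv_shift n _ 1 a) by (auto using affine_perm_comp_gen; lia).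
  apply shi_inv_comp_gen; auto.
Qed.

Lemma shi_length_ext n w w' : (forall x, w x = w' x) -> shi_length n w = shi_length n w'.
Proof. intros H. apply pairsum_ext. intros. rewrite !H. reflexivity. Qed.

Lemma shi_length_nonneg n w : 0 <= shi_length n w.
Proof. apply pairsum_nonneg. intros. lia. Qed.

Lemma affine_perm_ext n w w' : (forall x, w x = w' x) -> affine_perm n w -> affine_perm n w'.
Proof.
  intros H. rewrite !affine_permE. intros (Hi & Hs & Hp & Hd). repeat split.
  - intros x y E. rewrite <- !H in E. auto.
  - intros y. destruct (Hs y) as [x Hx]. exists x. rewrite <- H. auto.
  - intros i. rewrite <- !H. auto.
  - rewrite <- Hd. apply sumZ_ext. intros. rewrite H. reflexivity.
Qed.

(** An increasing bijection of the integers skips no value, hence is a translation; the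
    normalization makes the translation trivial. *)
Lemma affine_perm_increasing_id n w : affine_perm n w ->
  (forall a, w a < w (a + 1)) -> (1 <= n)%nat -> forall x, w x = x.
Proof.
  rewrite affine_permE. intros (Hi & Hs & Hp & Hd) Hlt Hn.
  assert (Hmono : forall (k : nat) a, w a <= w (a + Z.of_nat k) - Z.of_nat k).
  { induction k as [|k IH]; intros a; [rewrite Z.add_0_r; lia|].
    specialize (IH a). specialize (Hlt (a + Z.of_nat k)).
    replace (a + Z.of_nat (S k)) with (a + Z.of_nat k + 1) by lia. lia. }
  assert (Hstep : forall a, w (a + 1) = w a + 1).
  { intros a. destruct (Hs (w a + 1)) as [b Hb].
    destruct (Z_le_gt_dec b a) as [l|l].
    - pose proof (Hmono (Z.to_nat (a - b)) b) as M.
      replace (b + Z.of_nat (Z.to_nat (a - b))) with a in M by lia. lia.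
    - pose proof (Hmono (Z.to_nat (b - (a + 1))) (a + 1)) as M.
      replace (a + 1 + Z.of_nat (Z.to_nat (b - (a + 1)))) with b in M by lia.
      specialize (Hlt a). lia. }
  assert (Hc : forall a b, w a - a = w b - b).
  { apply (shift_invariant (fun a => w a - a)). intros a. rewrite Hstep. lia. }
  intros x. unfold displ in Hd.
  rewrite (sumZ_ext _ (fun _ => w x - x)) in Hd by (intros; apply Hc).
  rewrite sumZ_const in Hd. nia.
Qed.

(** * Length equals Shi's formula *)

Lemma word_fun_snoc n js j x :
  word_fun n (js ++ [j]) x = word_fun n js (gen n j x).
Proof. induction js as [|i js IH]; simpl; [reflexivity|]. f_equal. exact IH. Qed.

Lemma affine_perm_id n : affine_perm n (fun x => x).
Proof.
  apply affine_permE. repeat split; auto.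
  - intros y. exists y. reflexivity.
  - unfold displ. rewrite (sumZ_ext _ (fun _ => 0)) by (intros; lia).
    rewrite sumZ_const. lia.
Qed.

Lemma shi_length_id n : (1 <= n)%nat -> shi_length n (fun x => x) = 0.
Proof.
  intros Hn. unfold shi_length, shi_inv.
  rewrite (pairsum_ext _ (fun _ _ => 0)).
  - unfold pairsum. rewrite (sumZ_ext _ (fun _ => 0)); rewrite ?sumZ_const; try lia.
    intros; rewrite sumZ_const; lia.
  - intros i j Hij. rewrite Z.div_small; lia.
Qed.

(** Each appended letter changes Shi's formula by one, so the formula is a lower bound for the
    length of any word. *)
Lemma word_affine_length n js : (2 <= n)%nat ->
  affine_perm n (word_fun n js) /\
  shi_length n (word_fun n js) <= Z.of_nat (length js).
Proof.
  intros Hn. induction js as [|j js IH] using rev_ind.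
  - split; [apply affine_perm_id|]. rewrite shi_length_id; simpl; lia.
  - destruct IH as [Ha Hl].
    pose proof (affine_perm_comp_gen n j _ Hn Ha) as Ha'.
    pose proof (shi_length_comp_gen n j _ 0 Hn Ha) as Hl'. cbv zeta in Hl'.
    split.
    + eapply affine_perm_ext; [|exact Ha'].
      intros x. symmetry. apply word_fun_snoc.
    + rewrite (shi_length_ext n _ _ (word_fun_snoc n js j)).
      rewrite Hl', length_app. simpl length. destruct (_ <? _); lia.
Qed.

(** Every element other than the identity has a descent, and multiplying there by the generator
    lowers the formula by one; peeling off descents spells a word of exactly [k] letters. *)
Lemma shi_factorization n (k : nat) : (2 <= n)%nat -> forall w, affine_perm n w ->
  shi_length n w = Z.of_nat k ->
  exists js, length js = k /\ is_factorization n w js.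
Proof.
  intros Hn. induction k as [|k IH]; intros w Hw Hk.
  - exists []. split; [reflexivity|]. split; [constructor|].
    apply (affine_perm_increasing_id n); [assumption| |lia].
    (* A descent at [a] would push the nonnegative formula below zero. *)
    intros a. destruct (residue_decomp n 0 a) as (q & r & Ea & Hr); [lia|].
    pose proof (shi_length_comp_gen n (Z.to_nat r) w q Hn Hw) as H. cbv zeta in H.
    replace (Z.of_nat (Z.to_nat r) + q * Z.of_nat n) with a in H by lia.
    pose proof (shi_length_nonneg n (fun x => w (gen n (Z.to_nat r) x))).
    destruct (Z.ltb_spec (w a) (w (a + 1))); lia.
  - destruct (classic (exists a, w (a + 1) < w a)) as [[a Ha]|Hno].
    + destruct (residue_decomp n 0 a) as (q & r & Ea & Hr); [lia|].
      pose proof (shi_length_comp_gen n (Z.to_nat r) w q Hn Hw) as H. cbv zeta in H.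
      replace (Z.of_nat (Z.to_nat r) + q * Z.of_nat n) with a in H by lia.
      destruct (Z.ltb_spec (w a) (w (a + 1))); [lia|].
      destruct (IH _ (affine_perm_comp_gen n (Z.to_nat r) w Hn Hw)) as (js & Hl & Hf & He);
        [lia|].
      exists (js ++ [Z.to_nat r]). split; [rewrite length_app; simpl; lia|]. split.
      * apply Forall_app. split; [assumption|]. constructor; [lia|constructor].
      * intros x. rewrite word_fun_snoc, <- He, gen_involutive by lia. reflexivity.
    + exfalso. rewrite (shi_length_ext n w (fun x => x)), shi_length_id in Hk; [lia|lia|].
      apply (affine_perm_increasing_id n); [assumption| |lia]. intros a.
      assert (w a <> w (a + 1)) by (intros E; apply (proj1 Hw) in E; lia).
      destruct (Z_lt_ge_dec (w (a + 1)) (w a)); [exfalso; eauto|lia].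
Qed.

Lemma has_length_shi n w k : (2 <= n)%nat -> affine_perm n w ->
  (has_length n w k <-> shi_length n w = Z.of_nat k).
Proof.
  intros Hn Hw.
  assert (Hge : forall js, is_factorization n w js ->
     shi_length n w <= Z.of_nat (length js)).
  { intros js [_ He]. rewrite (shi_length_ext n _ _ He).
    apply word_affine_length; auto. }
  split.
  - intros [(js & Hl & Hf) Hmin].
    destruct (shi_factorization n (Z.to_nat (shi_length n w)) Hn w Hw) as (js' & Hl' & Hf').
    + pose proof (shi_length_nonneg n w). lia.
    + apply Hmin in Hf'. apply Hge in Hf. pose proof (shi_length_nonneg n w). lia.
  - intros Hk. split.
    + apply shi_factorization; auto.
    + intros js Hjs. apply Hge in Hjs. lia.
Qed.

(** * Boolean combinations of half-planes *)

Definition form : Type := (Z * Z * Z)%type.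

Definition lin (f : form) (q : Z * Z) : Z :=
  fst (fst f) * fst q + snd (fst f) * snd q.

Definition ev (f : form) (q : Z * Z) : Z := lin f q + snd f.

Definition fadd (f g : form) : form :=
  (fst (fst f) + fst (fst g), snd (fst f) + snd (fst g), snd f + snd g).

Lemma ev_fadd f g q : ev (fadd f g) q = ev f q + ev g q.
Proof. unfold ev, lin, fadd; simpl; ring. Qed.

Definition agree (L : list form) (q q' : Z * Z) : Prop :=
  forall f, In f L -> (ev f q <= 0 <-> ev f q' <= 0).

(* Equivalently: [P] is a Boolean combination of finitely many half-planes. *)
Definition determined (P : Z * Z -> Prop) : Prop :=
  exists L, forall q q', agree L q q' -> P q -> P q'.

Lemma agree_sym L q q' : agree L q q' -> agree L q' q.
Proof. intros H f Hf. specialize (H f Hf). tauto. Qed.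

Lemma agree_app L L' q q' : agree (L ++ L') q q' -> agree L q q' /\ agree L' q q'.
Proof. intros H; split; intros f Hf; apply H, in_or_app; auto. Qed.

Lemma determined_ext (P Q : Z * Z -> Prop) :
  (forall q, P q <-> Q q) -> determined P -> determined Q.
Proof.
  intros H [L HL]. exists L. intros q q' Ha Hq. apply H. apply H in Hq. eauto.
Qed.

Lemma determined_const (A : Prop) : determined (fun _ => A).
Proof. exists []. auto. Qed.

Lemma determined_atom f : determined (fun q => ev f q <= 0).
Proof. exists [f]. intros q q' H. apply (H f). left; reflexivity. Qed.

Lemma determined_not P : determined P -> determined (fun q => ~ P q).
Proof.
  intros [L HL]. exists L. intros q q' Ha Hn Hq'. apply Hn.
  apply (HL q'); auto using agree_sym.
Qed.

Lemma determined_and P Q :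
  determined P -> determined Q -> determined (fun q => P q /\ Q q).
Proof.
  intros [L HL] [L' HL']. exists (L ++ L'). intros q q' Ha [HP HQ].
  apply agree_app in Ha as [Ha Ha']. eauto.
Qed.

Lemma determined_or P Q :
  determined P -> determined Q -> determined (fun q => P q \/ Q q).
Proof.
  intros [L HL] [L' HL']. exists (L ++ L'). intros q q' Ha [HP|HQ];
  apply agree_app in Ha as [Ha Ha']; eauto.
Qed.

Lemma determined_exists_in {T} (l : list T) (P : T -> Z * Z -> Prop) :
  (forall x, determined (P x)) -> determined (fun q => exists x, In x l /\ P x q).
Proof.
  intros H. induction l as [|x l IH].
  - apply (determined_ext (fun _ => False)); [|apply determined_const].
    intros q. split; [tauto|]. intros (x & [] & _).
  - apply (determined_ext (fun q => P x q \/ exists y, In y l /\ P y q));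
      [|apply determined_or; auto].
    intros q. split.
    + intros [Hx|(y & Hy & HP)]; [exists x|exists y]; simpl; auto.
    + intros (y & [->|Hy] & HP); eauto.
Qed.

Lemma determined_forall_in {T} (l : list T) (P : T -> Z * Z -> Prop) :
  (forall x, determined (P x)) -> determined (fun q => forall x, In x l -> P x q).
Proof.
  intros H.
  apply (determined_ext (fun q => ~ exists x, In x l /\ ~ P x q)).
  - intros q. split.
    + intros Hn x Hx. apply NNPP. intros HP. apply Hn. eauto.
    + intros Ha (x & Hx & HP). auto.
  - apply determined_not, determined_exists_in. intros x. apply determined_not, H.
Qed.

Lemma determined_zero f : determined (fun q => ev f q = 0).
Proof.
  apply (determined_ext (fun q => ev f q <= 0 /\
    ev (- fst (fst f), - snd (fst f), - snd f) q <= 0)).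
  - intros q. unfold ev, lin; simpl. lia.
  - apply determined_and; apply determined_atom.
Qed.

(** * Elimination in systems of difference constraints *)

Definition sat (C : list (nat * nat * form)) (x : nat -> Z) (q : Z * Z) : Prop :=
  forall i j f, In (i, j, f) C -> x i + ev f q <= x j.

(** This supplies the value of the eliminated unknown. Induction over both lists, instead of taking
    a maximum, covers the case that one of them is empty. *)
Lemma between_lists (Ls Us : list Z) :
  (forall l u, In l Ls -> In u Us -> l <= u) ->
  exists z, (forall l, In l Ls -> l <= z) /\ (forall u, In u Us -> z <= u).
Proof.
  revert Us. induction Ls as [|l Ls IH]; intros Us H.
  - clear H. induction Us as [|u Us IH].
    + exists 0. split; intros ? [].
    + destruct IH as [z [_ Hz]]. exists (Z.min z u). split; [intros ? []|].
      intros v [->|Hv]; [lia|]. specialize (Hz v Hv). lia.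
  - destruct (IH Us) as [z [H1 H2]]; [intros; apply H; simpl; auto|].
    exists (Z.max z l). split.
    + intros l' [->|Hl']; [lia|]. specialize (H1 l' Hl'). lia.
    + intros u Hu. specialize (H2 u Hu). specialize (H l u ltac:(left; auto) Hu). lia.
Qed.

Definition csrc (c : nat * nat * form) : nat := fst (fst c).
Definition cdst (c : nat * nat * form) : nat := snd (fst c).

(* Fourier-Motzkin elimination of the last unknown.  Every coefficient is [1] or
   [-1], so it is exact over the integers. *)
Lemma determined_sat (k : nat) : forall C,
  (forall i j f, In (i, j, f) C -> (i < k)%nat /\ (j < k)%nat) ->
  determined (fun q => exists x, sat C x q).
Proof.
  induction k as [|k IH]; intros C HC.
  - apply (determined_ext (fun _ => True)); [|apply determined_const].
    intros q. split; [|auto]. intros _. exists (fun _ => 0). intros i j f Hin.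
    destruct (HC _ _ _ Hin); lia.
  - set (isk := fun m => Nat.eqb m k).
    (* [low] bounds the unknown [k] from below and [up] from above; [rest] does not involve it, and
       [self] compares it with itself, which is a condition on [q] alone. *)
    set (low := filter (fun c => negb (isk (csrc c)) && isk (cdst c))%bool C).
    set (up := filter (fun c => isk (csrc c) && negb (isk (cdst c)))%bool C).
    set (rest := filter (fun c => negb (isk (csrc c)) && negb (isk (cdst c)))%bool C).
    set (self := filter (fun c => isk (csrc c) && isk (cdst c))%bool C).
    (* Chaining a lower with an upper bound cancels the unknown [k] and adds the two forms, which is
       again a difference constraint. *)
    set (C' := rest ++ flat_map (fun c => map (fun d =>
      (csrc c, cdst d, fadd (snd c) (snd d))) up) low).
    assert (Hlow : forall i j f, In (i, j, f) low <->
      In (i, j, f) C /\ i <> k /\ j = k).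
    { intros. unfold low, isk, csrc, cdst. rewrite filter_In. simpl.
      destruct (Nat.eqb_spec i k), (Nat.eqb_spec j k); simpl; intuition congruence. }
    assert (Hup : forall i j f, In (i, j, f) up <->
      In (i, j, f) C /\ i = k /\ j <> k).
    { intros. unfold up, isk, csrc, cdst. rewrite filter_In. simpl.
      destruct (Nat.eqb_spec i k), (Nat.eqb_spec j k); simpl; intuition congruence. }
    assert (Hrest : forall i j f, In (i, j, f) rest <->
      In (i, j, f) C /\ i <> k /\ j <> k).
    { intros. unfold rest, isk, csrc, cdst. rewrite filter_In. simpl.
      destruct (Nat.eqb_spec i k), (Nat.eqb_spec j k); simpl; intuition congruence. }
    assert (Hself : forall i j f, In (i, j, f) self <->
      In (i, j, f) C /\ i = k /\ j = k).
    { intros. unfold self, isk, csrc, cdst. rewrite filter_In. simpl.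
      destruct (Nat.eqb_spec i k), (Nat.eqb_spec j k); simpl; intuition congruence. }
    assert (HC' : forall i j f, In (i, j, f) C' <-> In (i, j, f) rest \/
      exists g h, In (i, k, g) low /\ In (k, j, h) up /\ f = fadd g h).
    { intros. unfold C'. rewrite in_app_iff, in_flat_map. apply or_iff_compat_l. split.
      - intros ([[a b] g] & Hl & Hm). apply in_map_iff in Hm as ([[c d] h] & E & Hu).
        unfold csrc, cdst in E. simpl in E. injection E as <- <- <-.
        destruct (proj1 (Hlow _ _ _) Hl) as (_ & _ & ->).
        destruct (proj1 (Hup _ _ _) Hu) as (_ & -> & _). eauto.
      - intros (g & h & Hl & Hu & ->). exists (i, k, g). split; [assumption|].
        apply in_map_iff. exists (k, j, h). auto. }
    apply (determined_ext (fun q =>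
      (forall c, In c self -> ev (snd c) q <= 0) /\ exists x, sat C' x q)).
    + intros q. split.
      * intros [Hs [x Hx]].
        destruct (between_lists (map (fun c => x (csrc c) + ev (snd c) q) low)
          (map (fun c => x (cdst c) - ev (snd c) q) up)) as (z & Hz1 & Hz2).
        { intros l u Hl Hu. apply in_map_iff in Hl as ([[a b] g] & <- & Hl).
          apply in_map_iff in Hu as ([[c d] h] & <- & Hu).
          destruct (proj1 (Hlow _ _ _) Hl) as (_ & _ & ->).
          destruct (proj1 (Hup _ _ _) Hu) as (_ & -> & _).
          assert (In (a, d, fadd g h) C') as Hin by (apply HC'; right; eauto 6).
          apply Hx in Hin. rewrite ev_fadd in Hin. unfold csrc, cdst; simpl. lia. }
        exists (fun m => if Nat.eqb m k then z else x m). intros i j f Hin.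
        destruct (Nat.eqb_spec i k) as [->|Hi], (Nat.eqb_spec j k) as [->|Hj].
        -- assert (Hc : In (k, k, f) self) by (apply Hself; auto).
           apply Hs in Hc. simpl in Hc. lia.
        -- assert (Hc : In (k, j, f) up) by (apply Hup; auto).
           specialize (Hz2 (x j - ev f q)).
           rewrite in_map_iff in Hz2. specialize (Hz2 (ex_intro _ (k, j, f) (conj eq_refl Hc))). lia.
        -- assert (Hc : In (i, k, f) low) by (apply Hlow; auto).
           specialize (Hz1 (x i + ev f q)).
           rewrite in_map_iff in Hz1. specialize (Hz1 (ex_intro _ (i, k, f) (conj eq_refl Hc))). lia.
        -- apply Hx, HC'. left. apply Hrest. auto.
      * intros [x Hx]. split.
        -- intros [[a b] f] Hc. apply Hself in Hc as (Hc & -> & ->).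
           apply Hx in Hc. simpl. lia.
        -- exists x. intros i j f Hin. apply HC' in Hin as [Hr|(g & h & Hl & Hu & ->)].
           ++ apply Hx. apply Hrest in Hr. tauto.
           ++ apply Hlow in Hl as [Hl _]. apply Hup in Hu as [Hu _].
              apply Hx in Hl. apply Hx in Hu. rewrite ev_fadd. lia.
    + apply determined_and.
      * apply determined_forall_in. intros c. apply determined_atom.
      * apply IH. intros i j f Hin. apply HC' in Hin as [Hr|(g & h & Hl & Hu & _)].
        -- apply Hrest in Hr as (Hr & ? & ?). apply HC in Hr. lia.
        -- apply Hlow in Hl as (Hl & ? & _). apply Hup in Hu as (Hu & _ & ?).
           apply HC in Hl. apply HC in Hu. lia.
Qed.

(** * Thin and fat sets *)

Definition smul (t : Z) (q : Z * Z) : Z * Z := (t * fst q, t * snd q).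
Definition vadd (q r : Z * Z) : Z * Z := (fst q + fst r, snd q + snd r).

Lemma lin_smul f t q : lin f (smul t q) = t * lin f q.
Proof. unfold lin, smul; simpl; ring. Qed.

Lemma lin_vadd f q r : lin f (vadd q r) = lin f q + lin f r.
Proof. unfold lin, vadd; simpl; ring. Qed.

Definition thin (A : Z * Z -> Prop) : Prop :=
  exists ls : list form, (forall f, In f ls -> fst f <> (0, 0)) /\
    forall q, A q -> exists f, In f ls /\ ev f q = 0.

(* [A] contains the far part of an open cone around [q], and [q] is on none of the
   walls on which two of the three coordinates [u, v, -u-v] agree. *)
Definition fat (A : Z * Z -> Prop) : Prop :=
  exists q, fst q <> snd q /\ 2 * fst q + snd q <> 0 /\ fst q + 2 * snd q <> 0 /\
    forall r, exists t0, forall t s, t0 <= t -> 1 <= s -> A (smul s (vadd (smul t q) r)).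

Lemma exists_upper_bound {T} (l : list T) (g : T -> Z) :
  exists B, 0 <= B /\ forall x, In x l -> g x <= B.
Proof.
  induction l as [|x l (B & HB & IH)]; [exists 0; split; [lia|intros ? []]|].
  exists (Z.max B (g x)). split; [lia|]. intros y [->|Hy]; [lia|].
  specialize (IH y Hy). lia.
Qed.

Definition zrange (c : Z) : list Z :=
  map (fun i => Z.of_nat i - Z.abs c) (seq 0 (Z.to_nat (2 * Z.abs c + 1))).

Lemma in_zrange c z : Z.abs z <= Z.abs c -> In z (zrange c).
Proof.
  intros H. apply in_map_iff. exists (Z.to_nat (z + Z.abs c)).
  split; [lia|]. apply in_seq. lia.
Qed.

(* A point at which every non-constant linear part dominates its constant term
   keeps all atoms unchanged under scaling, so it spans a cone in [A]; if there is
   no such point then [A] is covered by the lines [lin f = e] with [|e| <= |c|]. *)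
Lemma determined_thin_or_fat A : determined A -> thin A \/ fat A.
Proof.
  intros [L0 HL0].
  (* The three added forms are the walls; as their constants are 0, the domination condition below
     says that [q] lies on none of them. *)
  set (L := (1, -1, 0) :: (2, 1, 0) :: (1, 2, 0) :: L0).
  destruct (classic (exists q, A q /\ forall f, In f L ->
    fst f = (0, 0) \/ Z.abs (snd f) < Z.abs (lin f q))) as [(q & Hq & Hw)|Hno].
  - right. exists q.
    assert (H1 := Hw _ (or_introl eq_refl)).
    assert (H2 := Hw _ (or_intror (or_introl eq_refl))).
    assert (H3 := Hw _ (or_intror (or_intror (or_introl eq_refl)))).
    unfold lin in H1, H2, H3; simpl fst in *; simpl snd in *.
    repeat split.
    + destruct H1 as [H1|H1]; [discriminate|]. lia.
    + destruct H2 as [H2|H2]; [discriminate|]. lia.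
    + destruct H3 as [H3|H3]; [discriminate|]. lia.
    + clear H1 H2 H3. intros r.
      destruct (exists_upper_bound L (fun f => Z.abs (lin f r))) as (B & HB & Hr).
      (* For [t >= B + 1] and [x] nonzero, [t x + y] has the sign of [x] and at least its absolute
         value. Scaling by [s >= 1] preserves this, so the constant term still cannot change the
         truth of the atom. *)
      exists (B + 1). intros t s Ht Hs. apply (HL0 q); [|assumption].
      intros f Hf. assert (HfL : In f L) by (do 3 right; assumption).
      specialize (Hw f HfL). specialize (Hr f HfL). cbv beta in Hr. unfold ev.
      rewrite lin_smul, lin_vadd, lin_smul.
      destruct Hw as [E|Hw].
      * destruct f as [[a b] c]. simpl in E. injection E as -> ->.
        unfold lin; simpl. lia.
      * set (x := lin f q) in *. set (y := lin f r) in *. set (c := snd f) in *.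
        destruct (Z_lt_ge_dec 0 x).
        -- assert (x <= t * x + y) by nia.
           assert (x <= s * (t * x + y)) by nia. lia.
        -- assert (t * x + y <= x) by nia.
           assert (s * (t * x + y) <= x) by nia. lia.
  - left.
    exists (flat_map (fun f => map (fun e => (fst f, e)) (zrange (snd f)))
      (filter (fun f => negb (Z.eqb (fst (fst f)) 0 && Z.eqb (snd (fst f)) 0)) L)).
    split.
    + intros f Hf. apply in_flat_map in Hf as (g & Hg & Hm).
      apply in_map_iff in Hm as (e & <- & _). apply filter_In in Hg as [_ Hg]. simpl.
      intros E. rewrite E in Hg. discriminate.
    + intros q Hq.
      assert (exists f, In f L /\ fst f <> (0, 0) /\ Z.abs (lin f q) <= Z.abs (snd f))
        as (f & Hf & Hne & Hle).
      { apply NNPP. intros Hn. apply Hno. exists q. split; [assumption|]. intros f Hf.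
        destruct (classic (fst f = (0, 0))); [auto|right].
        apply Znot_ge_lt. intros Hge. apply Hn. exists f. repeat split; auto. lia. }
      exists (fst f, - lin f q). split; [|unfold ev, lin; simpl; lia].
      apply in_flat_map. exists f. split.
      * apply filter_In. split; [assumption|]. destruct f as [[a b] c]. simpl in *.
        destruct (Z.eqb_spec a 0), (Z.eqb_spec b 0); auto. exfalso. apply Hne. congruence.
      * apply in_map_iff. exists (- lin f q). split; [reflexivity|].
        apply in_zrange. lia.
Qed.

(** * Eventually periodic counting *)

(** [coeff] is convertible to the instance of this for the windows of avoiders. *)
Definition card_is {X} (P : X -> Prop) (c : nat) : Prop :=
  exists l : list X, NoDup l /\ length l = c /\ forall x, In x l <-> P x.

Lemma card_is_le {X} (P : X -> Prop) c l :
  card_is P c -> NoDup l -> (forall x, In x l -> P x) -> (length l <= c)%nat.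
Proof.
  intros (l' & _ & <- & H) Hl HP. apply NoDup_incl_length; [assumption|].
  intros x Hx. apply H. auto.
Qed.

Lemma card_is_unique {X} (P : X -> Prop) c c' : card_is P c -> card_is P c' -> c = c'.
Proof.
  intros (l & Hl & E & HP) (l' & Hl' & E' & HP').
  apply Nat.le_antisymm.
  - rewrite <- E. apply (card_is_le P); [exists l'; auto|auto|]. intros; apply HP; auto.
  - rewrite <- E'. apply (card_is_le P); [exists l; auto|auto|]. intros; apply HP'; auto.
Qed.

Lemma card_is_ext {X} (P Q : X -> Prop) c :
  (forall x, P x <-> Q x) -> card_is P c -> card_is Q c.
Proof.
  intros H (l & H1 & H2 & H3). exists l. repeat split; auto; intros ?.
  - apply H, H3; auto.
  - apply H3, H; auto.
Qed.

Lemma card_is_none {X} (P : X -> Prop) : (forall x, ~ P x) -> card_is P 0.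
Proof.
  intros H. exists []. split; [constructor|]. split; [reflexivity|].
  intros x. split; [intros []|]. intros Hx. destruct (H x Hx).
Qed.

Lemma card_is_one {X} (P : X -> Prop) y : (forall x, P x <-> x = y) -> card_is P 1.
Proof.
  intros H. exists [y]. split; [repeat constructor; intros []|]. split; [reflexivity|].
  intros x. rewrite H. simpl. intuition.
Qed.

Lemma card_is_union {X} (P Q : X -> Prop) c d :
  (forall x, P x -> Q x -> False) -> card_is P c -> card_is Q d ->
  card_is (fun x => P x \/ Q x) (c + d).
Proof.
  intros HPQ (l & H1 & <- & H3) (m & K1 & <- & K3). exists (l ++ m).
  split; [|split].
  - apply NoDup_app; auto. intros x Hx Hm. apply (HPQ x); [apply H3|apply K3]; auto.
  - apply length_app.
  - intros x. rewrite in_app_iff, H3, K3. tauto.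
Qed.

Lemma card_is_image {X Y} (h : X -> Y) (P : X -> Prop) c :
  (forall x x', h x = h x' -> x = x') -> card_is P c ->
  card_is (fun y => exists x, P x /\ y = h x) c.
Proof.
  intros Hh (l & H1 & <- & H3). exists (map h l). split; [|split].
  - apply FinFun.Injective_map_NoDup; auto.
  - apply length_map.
  - intros y. rewrite in_map_iff. split.
    + intros (x & <- & Hx). exists x. rewrite <- H3. auto.
    + intros (x & Hx & ->). exists x. rewrite H3. auto.
Qed.

(** The count [c] may depend on [i] but not on [k]. Its existence includes finiteness, and following
    whole progressions lets a union use the product of two periods. *)
Definition eventually_periodic {X} (P : nat -> X -> Prop) : Prop :=
  exists N i0 : nat, (1 <= N)%nat /\
    forall i, (i0 <= i)%nat -> exists c, forall k, card_is (P (i + k * N)%nat) c.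

Lemma ep_ext {X} (P Q : nat -> X -> Prop) :
  (forall i x, P i x <-> Q i x) -> eventually_periodic P -> eventually_periodic Q.
Proof.
  intros H (N & i0 & HN & HP). exists N, i0. split; [assumption|].
  intros i Hi. destruct (HP i Hi) as [c Hc]. exists c. intros k.
  apply (card_is_ext (P (i + k * N)%nat)); auto.
Qed.

Lemma ep_empty {X} (P : nat -> X -> Prop) :
  (forall i x, ~ P i x) -> eventually_periodic P.
Proof.
  intros H. exists 1%nat, 0%nat. split; [lia|]. intros i _. exists 0%nat.
  intros k. apply card_is_none, H.
Qed.

Lemma ep_union {X} (P Q : nat -> X -> Prop) :
  (forall i x, P i x -> Q i x -> False) ->
  eventually_periodic P -> eventually_periodic Q ->
  eventually_periodic (fun i x => P i x \/ Q i x).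
Proof.
  intros HPQ (N & i0 & HN & HP) (M & j0 & HM & HQ).
  exists (N * M)%nat, (i0 + j0)%nat. split; [nia|]. intros i Hi.
  destruct (HP i ltac:(lia)) as [c Hc]. destruct (HQ i ltac:(lia)) as [d Hd].
  exists (c + d)%nat. intros k. apply card_is_union; [apply HPQ| |].
  - replace (i + k * (N * M))%nat with (i + (k * M) * N)%nat by lia. apply Hc.
  - replace (i + k * (N * M))%nat with (i + (k * N) * M)%nat by lia. apply Hd.
Qed.

Lemma ep_image {X Y} (h : X -> Y) (P : nat -> X -> Prop) :
  (forall x x', h x = h x' -> x = x') -> eventually_periodic P ->
  eventually_periodic (fun i y => exists x, P i x /\ y = h x).
Proof.
  intros Hh (N & i0 & HN & HP). exists N, i0. split; [assumption|].
  intros i Hi. destruct (HP i Hi) as [c Hc]. exists c. intros k.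
  apply card_is_image; auto.
Qed.

Lemma ep_union_list {S X} (l : list S) (P : S -> nat -> X -> Prop) :
  (forall s s' i x, In s l -> In s' l -> P s i x -> P s' i x -> s = s') ->
  (forall s, In s l -> eventually_periodic (P s)) ->
  eventually_periodic (fun i x => exists s, In s l /\ P s i x).
Proof.
  induction l as [|s l IH]; intros Hd H.
  - apply ep_empty. intros i x (s & [] & _).
  - destruct (classic (In s l)) as [Hin|Hin].
    + apply (ep_ext (fun i x => exists s, In s l /\ P s i x)).
      * intros i x. split.
        -- intros (s' & Hs' & HP). exists s'. simpl; auto.
        -- intros (s' & [<-|Hs'] & HP); eauto.
      * apply IH; [intros s1 s2 i x ? ?; apply Hd; simpl; auto|].
        intros; apply H; simpl; auto.
    + apply (ep_ext (fun i x => P s i x \/ exists s, In s l /\ P s i x)).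
      * intros i x. split.
        -- intros [HP|(s' & Hs' & HP)]; [exists s|exists s']; simpl; auto.
        -- intros (s' & [<-|Hs'] & HP); eauto.
      * apply ep_union.
        -- intros i x HP (s' & Hs' & HP'). apply Hin.
           rewrite (Hd s s' i x); simpl; auto.
        -- apply H; simpl; auto.
        -- apply IH; [intros s1 s2 i x ? ?; apply Hd; simpl; auto|].
        intros; apply H; simpl; auto.
Qed.

(** Far out the length is [s t + c], so a large [i] is attained at most once, and whether it is
    depends only on [i] modulo [s] and on the eventual truth value of [T]. *)
Lemma ep_ray (T : nat -> Prop) (len : nat -> Z) (t0 : nat) (s c : Z) :
  1 <= s ->
  (forall t, (t0 <= t)%nat -> (T t <-> T t0)) ->
  (forall t, (t0 <= t)%nat -> len t = s * Z.of_nat t + c) ->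
  eventually_periodic (fun i t => T t /\ len t = Z.of_nat i).
Proof.
  intros Hs HT Hlen.
  (* [B] bounds the lengths up to [t0], so a length above [B] can only come from the affine
     range. *)
  destruct (exists_upper_bound (seq 0 (S t0)) len) as (B & HB & Hb).
  exists (Z.to_nat s), (Z.to_nat (B + 1)). split; [lia|]. intros i Hi.
  assert (Hbig : forall k t, len t = Z.of_nat (i + k * Z.to_nat s) -> (t0 < t)%nat).
  { intros k t Et. destruct (le_lt_dec t t0); [|assumption].
    specialize (Hb t ltac:(apply in_seq; lia)). lia. }
  assert (HB0 := Hb t0 ltac:(apply in_seq; lia)). rewrite Hlen in HB0 by lia.
  destruct (classic (T t0)) as [Ht0|Ht0].
  - destruct (Z.eq_dec ((Z.of_nat i - c) mod s) 0) as [Hm|Hm].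
    + exists 1%nat. intros k.
      set (d := (Z.of_nat i - c) / s).
      assert (Ed : Z.of_nat i - c = s * d).
      { pose proof (Z.div_mod (Z.of_nat i - c) s ltac:(lia)). unfold d. lia. }
      assert (Hd : Z.of_nat t0 < d) by nia.
      apply (card_is_one _ (Z.to_nat (d + Z.of_nat k))). intros t. split.
      * intros [_ Et]. specialize (Hbig k t Et). rewrite Hlen in Et by lia.
        assert (s * Z.of_nat t = s * (d + Z.of_nat k)) by nia.
        assert (Z.of_nat t = d + Z.of_nat k) by nia. lia.
      * intros ->. split; [apply HT; [lia|assumption]|]. rewrite Hlen by lia. nia.
    + exists 0%nat. intros k. apply card_is_none. intros t [_ Et].
      specialize (Hbig k t Et). rewrite Hlen in Et by lia. apply Hm.
      replace (Z.of_nat i - c) with ((Z.of_nat t - Z.of_nat k) * s) by nia.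
      apply Z.mod_mul. lia.
  - exists 0%nat. intros k. apply card_is_none. intros t [Tt Et].
    specialize (Hbig k t Et). apply Ht0, (HT t); [lia|assumption].
Qed.

(** From [t >= |g|] on, [t a] outweighs [g] unless [a = 0], so the sign inside the absolute value is
    settled. *)
Lemma eventually_abs_affine (a g : Z) :
  exists t0 : nat, exists c, forall t, (t0 <= t)%nat ->
    Z.abs (g + Z.of_nat t * a) = Z.abs a * Z.of_nat t + c.
Proof.
  exists (Z.to_nat (Z.abs g)).
  destruct (Z.lt_trichotomy a 0) as [Ha|[Ha|Ha]].
  - exists (- g). intros t Ht. assert (g + Z.of_nat t * a <= 0) by nia. lia.
  - exists (Z.abs g). intros t Ht. subst a. lia.
  - exists g. intros t Ht. assert (0 <= g + Z.of_nat t * a) by nia. lia.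
Qed.

(** Along a ray each form is affine in [t], and its sign is eventually that of its slope. The
    threshold is [B + 1] because an atom is the weak inequality [<= 0], so a positive slope must
    yield a strictly positive value. *)
Lemma determined_eventually_constant A q V : determined A ->
  exists t0 : nat, forall t, (t0 <= t)%nat ->
    (A (vadd q (smul (Z.of_nat t) V)) <-> A (vadd q (smul (Z.of_nat t0) V))).
Proof.
  intros [L HL].
  destruct (exists_upper_bound L (fun f => Z.abs (ev f q))) as (B & HB & Hb).
  exists (Z.to_nat (B + 1)). intros t Ht.
  cut (agree L (vadd q (smul (Z.of_nat t) V))
    (vadd q (smul (Z.of_nat (Z.to_nat (B + 1))) V))).
  { intros Ha. split; apply HL; auto using agree_sym. }
  intros f Hf. specialize (Hb f Hf). cbv beta in Hb.
  assert (E : forall t, ev f (vadd q (smul t V)) = ev f q + t * lin f V).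
  { intros x. unfold ev. rewrite lin_vadd, lin_smul. lia. }
  rewrite !E. rewrite Z2Nat.id by lia.
  destruct (Z.lt_trichotomy (lin f V) 0) as [Ha|[Ha|Ha]].
  - assert (ev f q + Z.of_nat t * lin f V <= 0) by nia.
    assert (ev f q + (B + 1) * lin f V <= 0) by nia. lia.
  - rewrite Ha. lia.
  - assert (0 < ev f q + Z.of_nat t * lin f V) by nia.
    assert (0 < ev f q + (B + 1) * lin f V) by nia. lia.
Qed.

(** * Counting on lines of the plane *)

Definition abs_len (f1 f2 f3 : form) (q : Z * Z) : Z :=
  Z.abs (ev f1 q) + Z.abs (ev f2 q) + Z.abs (ev f3 q).

(** This ensures that [abs_len] really grows along every ray: at least one of the three forms has
    nonzero slope. *)
Definition separating (f1 f2 f3 : form) : Prop :=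
  forall V, lin f1 V = 0 -> lin f2 V = 0 -> lin f3 V = 0 -> V = (0, 0).

Lemma pair_eq (q r : Z * Z) : fst q = fst r -> snd q = snd r -> q = r.
Proof. destruct q, r; simpl; congruence. Qed.

(** The ray is parametrized injectively by [t], which reduces the count to [ep_ray] with the sum of
    the three absolute slopes as growth rate. *)
Lemma ep_ray_plane f1 f2 f3 A q V : separating f1 f2 f3 -> determined A -> V <> (0, 0) ->
  eventually_periodic (fun i r =>
    exists t : nat, (A r /\ abs_len f1 f2 f3 r = Z.of_nat i) /\
      r = vadd q (smul (Z.of_nat t) V)).
Proof.
  intros Hsep HA HV.
  set (h := fun t : nat => vadd q (smul (Z.of_nat t) V)).
  apply (ep_ext (fun i r => exists t : nat,
    (A (h t) /\ abs_len f1 f2 f3 (h t) = Z.of_nat i) /\ r = h t)).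
  { intros i r. split; intros (t & H & ->); exists t; auto. }
  apply ep_image.
  - intros t t' E. unfold h, vadd, smul in E. simpl in E. injection E as E1 E2.
    destruct V as [a b]; simpl in *.
    assert ((Z.of_nat t - Z.of_nat t') * a = 0) by lia.
    assert ((Z.of_nat t - Z.of_nat t') * b = 0) by lia.
    destruct (Z.eq_dec a 0); [|nia]. destruct (Z.eq_dec b 0); [|nia].
    exfalso. apply HV. congruence.
  - destruct (determined_eventually_constant A q V HA) as [t0 Ht0].
    destruct (eventually_abs_affine (lin f1 V) (ev f1 q)) as (t1 & c1 & H1).
    destruct (eventually_abs_affine (lin f2 V) (ev f2 q)) as (t2 & c2 & H2).
    destruct (eventually_abs_affine (lin f3 V) (ev f3 q)) as (t3 & c3 & H3).
    apply (ep_ray (fun t => A (h t)) (fun t => abs_len f1 f2 f3 (h t))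
      (t0 + t1 + t2 + t3)
      (Z.abs (lin f1 V) + Z.abs (lin f2 V) + Z.abs (lin f3 V)) (c1 + c2 + c3)).
    + destruct (Z_le_gt_dec 1
        (Z.abs (lin f1 V) + Z.abs (lin f2 V) + Z.abs (lin f3 V))); [assumption|].
      exfalso. apply HV, Hsep; lia.
    + intros t Ht. unfold h. rewrite (Ht0 t), (Ht0 (t0 + t1 + t2 + t3)%nat) by lia.
      reflexivity.
    + intros t Ht. unfold abs_len, h, ev in *. rewrite !lin_vadd, !lin_smul.
      specialize (H1 t ltac:(lia)). specialize (H2 t ltac:(lia)).
      specialize (H3 t ltac:(lia)).
      replace (lin f1 q + Z.of_nat t * lin f1 V + snd f1)
        with (lin f1 q + snd f1 + Z.of_nat t * lin f1 V) by lia.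
      replace (lin f2 q + Z.of_nat t * lin f2 V + snd f2)
        with (lin f2 q + snd f2 + Z.of_nat t * lin f2 V) by lia.
      replace (lin f3 q + Z.of_nat t * lin f3 V + snd f3)
        with (lin f3 q + snd f3 + Z.of_nat t * lin f3 V) by lia.
      rewrite H1, H2, H3. ring.
Qed.

(** The integer points of a line form two disjoint opposite rays issuing from a point of [A]. *)
Lemma ep_line f1 f2 f3 A g : separating f1 f2 f3 -> determined A -> fst g <> (0, 0) ->
  (forall q, A q -> ev g q = 0) ->
  eventually_periodic (fun i q => A q /\ abs_len f1 f2 f3 q = Z.of_nat i).
Proof.
  intros Hsep HA Hg Hline.
  destruct (classic (exists q, A q)) as [[q Hq]|Hno];
    [|apply ep_empty; intros i x [Hx _]; eauto].
  destruct g as [[a b] c]. simpl in Hg.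
  (* Dividing the normal vector by its gcd gives a primitive direction, so that every integer point
     of the line is reached by an integer parameter. *)
  set (d := Z.gcd a b).
  assert (Hd : d <> 0).
  { unfold d. intros E. apply Z.gcd_eq_0 in E as [-> ->]. auto. }
  destruct (Z.gcd_divide_l a b) as [a' Ea]. destruct (Z.gcd_divide_r a b) as [b' Eb].
  fold d in Ea, Eb.
  destruct (Z.gcd_bezout a b d eq_refl) as (x & y & Exy).
  clearbody d.
  assert (Hxy : x * a' + y * b' = 1).
  { apply (Z.mul_reg_r _ _ d Hd). rewrite Ea, Eb in Exy. lia. }
  set (V := (b', - a')).
  assert (HV : V <> (0, 0)).
  { intros E. pose proof (f_equal fst E) as E1. pose proof (f_equal snd E) as E2.
    unfold V in E1, E2. cbn [fst snd] in E1, E2.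
    assert (Ha : a' = 0) by lia. rewrite Ha, E1 in Hxy. lia. }
  assert (HmV : smul (-1) V <> (0, 0)).
  { intros E. apply HV. pose proof (f_equal fst E) as E1. pose proof (f_equal snd E) as E2.
    unfold V, smul in E1, E2. cbn [fst snd] in E1, E2. unfold V. f_equal; lia. }
  assert (Hpar : forall r, A r -> exists t, r = vadd q (smul t V)).
  { intros r Hr. apply Hline in Hr. assert (Hq0 := Hline q Hq).
    unfold ev, lin in *. simpl in Hr, Hq0.
    destruct q as [u v], r as [u' v']. simpl in Hr, Hq0.
    assert (E : a' * (u' - u) + b' * (v' - v) = 0) by nia.
    (* Pairing the displacement [t (b', -a')] with the Bezout coefficients as [(y, -x)] recovers
       [t]. *)
    exists ((u' - u) * y - (v' - v) * x).
    unfold vadd, smul, V; simpl. f_equal.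
    - replace (((u' - u) * y - (v' - v) * x) * b') with
        ((u' - u) * (x * a' + y * b') - x * (a' * (u' - u) + b' * (v' - v))) by ring.
      rewrite E, Hxy. lia.
    - replace (((u' - u) * y - (v' - v) * x) * - a') with
        ((v' - v) * (x * a' + y * b') - y * (a' * (u' - u) + b' * (v' - v))) by ring.
      rewrite E, Hxy. lia. }
  (* The second ray starts at [q - V], so that [q] is not counted twice. *)
  apply (ep_ext (fun i r =>
    (exists t : nat, (A r /\ abs_len f1 f2 f3 r = Z.of_nat i) /\
       r = vadd q (smul (Z.of_nat t) V)) \/
    (exists t : nat, (A r /\ abs_len f1 f2 f3 r = Z.of_nat i) /\
       r = vadd (vadd q (smul (-1) V)) (smul (Z.of_nat t) (smul (-1) V))))).
  - intros i r. split; [intros [(t & H & _)|(t & H & _)]; exact H|].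
    intros [Hr Hi]. destruct (Hpar r Hr) as [t Et].
    destruct (Z_le_gt_dec 0 t).
    + left. exists (Z.to_nat t). split; [auto|]. rewrite Z2Nat.id by lia. assumption.
    + right. exists (Z.to_nat (- t - 1)). split; [auto|]. rewrite Z2Nat.id by lia.
      rewrite Et. unfold vadd, smul; cbn [fst snd]. f_equal; ring.
  - apply ep_union; [|apply ep_ray_plane; auto|apply ep_ray_plane; auto].
    intros i r (t & _ & ->) (t' & _ & E).
    pose proof (f_equal fst E) as E1. pose proof (f_equal snd E) as E2.
    unfold vadd, smul, V in E1, E2. cbn [fst snd] in E1, E2.
    assert (E1' : (Z.of_nat t + Z.of_nat t' + 1) * b' = 0) by lia.
    assert (E2' : (Z.of_nat t + Z.of_nat t' + 1) * a' = 0) by lia.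
    apply Z.mul_eq_0 in E1' as [?|?]; [lia|].
    apply Z.mul_eq_0 in E2' as [?|?]; [lia|]. nia.
Qed.

(** The lines are peeled off one at a time. Passing on only the points off [g] keeps the union
    disjoint where lines cross. *)
Lemma ep_thin f1 f2 f3 A : separating f1 f2 f3 -> determined A -> thin A ->
  eventually_periodic (fun i q => A q /\ abs_len f1 f2 f3 q = Z.of_nat i).
Proof.
  intros Hsep HA (ls & Hls & Hcov). revert A HA Hcov.
  induction ls as [|g ls IH]; intros A HA Hcov.
  - apply ep_empty. intros i q [Hq _]. destruct (Hcov q Hq) as (f & [] & _).
  - apply (ep_ext (fun i q =>
      ((A q /\ ev g q = 0) /\ abs_len f1 f2 f3 q = Z.of_nat i) \/
      ((A q /\ ev g q <> 0) /\ abs_len f1 f2 f3 q = Z.of_nat i))).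
    { intros i q. destruct (Z.eq_dec (ev g q) 0); tauto. }
    apply ep_union; [tauto| |].
    + apply (ep_line f1 f2 f3 (fun q => A q /\ ev g q = 0) g); auto.
      * apply determined_and; auto using determined_zero.
      * apply Hls; simpl; auto.
      * tauto.
    + apply (IH (fun f Hf => Hls f (or_intror Hf)) (fun q => A q /\ ev g q <> 0)).
      * apply determined_and; auto. apply determined_not, determined_zero.
      * intros q [Hq Hn]. destruct (Hcov q Hq) as (f & [<-|Hf] & E); [tauto|eauto].
Qed.

(** * Affine permutations of size 3 *)

(** Every argument other than 0 and 1 selects [c]: in size 3 this is the residue 2, in size [n] it
    lumps the residues from 2 to [n - 1] into one class. *)
Definition pick {T} (a b c : T) (r : Z) : T :=
  if r =? 0 then a else if r =? 1 then b else c.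

Definition scoord (s : Z * Z * Z) (r : Z) : Z :=
  pick (fst (fst s)) (snd (fst s)) (snd s) r.

Definition mlin (r : Z) : Z * Z := pick (1, 0) (0, 1) (-1, -1) r.

Definition mcoord (q : Z * Z) (r : Z) : Z := pick (fst q) (snd q) (- fst q - snd q) r.

(* The element of the affine group with window entries [3 m_r + s_r], where
   [m = (u, v, -u-v)]; positions are [3 k + r + 1] with [r = 0, 1, 2]. *)
Definition W3 (s : Z * Z * Z) (q : Z * Z) (x : Z) : Z :=
  3 * ((x - 1) / 3) + 3 * mcoord q ((x - 1) mod 3) + scoord s ((x - 1) mod 3).

Definition residues3 : list (Z * Z * Z) :=
  [(1, 2, 3); (1, 3, 2); (2, 1, 3); (2, 3, 1); (3, 1, 2); (3, 2, 1)].

Lemma W3_at s q x c : 0 <= c < 3 ->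
  W3 s q (3 * x + c + 1) = 3 * x + 3 * mcoord q c + scoord s c.
Proof.
  intros Hc. unfold W3.
  replace ((3 * x + c + 1 - 1) / 3) with x by (Z.to_euclidean_division_equations; lia).
  replace ((3 * x + c + 1 - 1) mod 3) with c by (Z.to_euclidean_division_equations; lia).
  reflexivity.
Qed.

Lemma mcoord_diff q c d e : 0 <= c < 3 -> 0 <= d < 3 ->
  ev (fst (mlin c) - fst (mlin d), snd (mlin c) - snd (mlin d), e) q
  = mcoord q c - mcoord q d + e.
Proof.
  intros Hc Hd. unfold ev, lin, mlin, mcoord, pick.
  destruct (Z.eqb_spec c 0), (Z.eqb_spec c 1), (Z.eqb_spec d 0), (Z.eqb_spec d 1);
    cbn [fst snd]; lia.
Qed.

(** * Occurrences of a pattern as difference constraints *)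

Fixpoint colorings (k : nat) : list (list Z) :=
  match k with
  | O => [[]]
  | S k => flat_map (fun c => [0 :: c; 1 :: c; 2 :: c]) (colorings k)
  end.

Lemma in_colorings k c :
  In c (colorings k) <-> length c = k /\ Forall (fun r => 0 <= r < 3) c.
Proof.
  revert c; induction k as [|k IH]; intros c; simpl colorings.
  - split.
    + intros [<-|[]]. auto.
    + intros [H _]. destruct c; [left; reflexivity|discriminate].
  - rewrite in_flat_map. split.
    + intros (d & Hd & H). apply IH in Hd as [Hl Hf].
      destruct H as [<-|[<-|[<-|[]]]]; simpl; split; auto; constructor; auto; lia.
    + intros [Hl Hf]. destruct c as [|r c]; [discriminate|].
      inversion Hf; subst. exists c. split; [apply IH; split; auto|].
      assert (r = 0 \/ r = 1 \/ r = 2) as [->|[->| ->]] by lia; simpl; auto.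
Qed.

Definition col (chi : list Z) (a : nat) : Z := nth a chi 0.

(** The strict inequality between the positions [3 x a + col chi a + 1] and [3 x b + col chi b + 1],
    divided by 3; adding 3 under the floor rounds the bound up to the next integer. *)
Definition pos_constraint (chi : list Z) (a b : nat) : list (nat * nat * form) :=
  if (a <? b)%nat then [(a, b, (0, 0, (col chi a - col chi b + 3) / 3))] else [].

(** The bound obtained by comparing two values given by [W3_at] and dividing by 3: the coordinates
    contribute the linear part, the residues the rounded constant. *)
Definition val_form (s : Z * Z * Z) (chi : list Z) (a b : nat) (e : Z) : form :=
  (fst (mlin (col chi a)) - fst (mlin (col chi b)), snd (mlin (col chi a)) - snd (mlin (col chi b)),
   (scoord s (col chi a) - scoord s (col chi b) + e) / 3).

(* [e = 3] encodes a strict inequality between values, [e = 2] a weak one. *)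
Definition val_constraint (p : list nat) (s : Z * Z * Z) (chi : list Z) (a b : nat)
  : nat * nat * form :=
  if (nth a p 0 <? nth b p 0)%nat then (a, b, val_form s chi a b 3) else (b, a, val_form s chi b a 2).

Definition constraints (p : list nat) (s : Z * Z * Z) (chi : list Z) : list (nat * nat * form) :=
  flat_map (fun a => flat_map (fun b => val_constraint p s chi a b :: pos_constraint chi a b)
    (seq 0 (length p))) (seq 0 (length p)).

Lemma in_constraints p s chi c : In c (constraints p s chi) <->
  exists a b, (a < length p)%nat /\ (b < length p)%nat /\
    (c = val_constraint p s chi a b \/ In c (pos_constraint chi a b)).
Proof.
  unfold constraints. rewrite in_flat_map. split.
  - intros (a & Ha & H). apply in_flat_map in H as (b & Hb & H).
    apply in_seq in Ha, Hb. exists a, b. repeat split; try lia.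
    destruct H as [H|H]; auto.
  - intros (a & b & Ha & Hb & H). exists a. split; [apply in_seq; lia|].
    apply in_flat_map. exists b. split; [apply in_seq; lia|].
    destruct H as [H|H]; simpl; auto.
Qed.

(** Once the residue of each position is fixed by [chi], an occurrence of [p] is a choice of the
    quotients [x]. As these are integers, the rounding in the constraints loses nothing. *)
Lemma sat_constraints p s chi q x :
  (forall a, (a < length p)%nat -> 0 <= col chi a < 3) ->
  let idx a := 3 * x a + col chi a + 1 in
  sat (constraints p s chi) x q <->
  (forall a b, (a < b < length p)%nat -> idx a < idx b) /\
  (forall a b, (a < length p)%nat -> (b < length p)%nat ->
     (W3 s q (idx a) < W3 s q (idx b) <-> (nth a p 0 < nth b p 0)%nat)).
Proof.
  intros Hcol idx.
  assert (HW : forall a, (a < length p)%nat ->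
    W3 s q (idx a) = 3 * x a + 3 * mcoord q (col chi a) + scoord s (col chi a)).
  { intros a Ha. apply W3_at. auto. }
  assert (Hval : forall a b e, (a < length p)%nat -> (b < length p)%nat ->
    ev (val_form s chi a b e) q = mcoord q (col chi a) - mcoord q (col chi b) +
      (scoord s (col chi a) - scoord s (col chi b) + e) / 3).
  { intros. unfold val_form. apply mcoord_diff; auto. }
  split.
  - intros Hs. split.
    + intros a b Hab.
      assert (Hin : In (a, b, (0, 0, (col chi a - col chi b + 3) / 3)) (constraints p s chi)).
      { apply in_constraints. exists a, b. repeat split; try lia. right.
        unfold pos_constraint. destruct (Nat.ltb_spec a b); [left; reflexivity|lia]. }
      apply Hs in Hin. unfold ev, lin in Hin. cbn [fst snd] in Hin. unfold idx.
      Z.to_euclidean_division_equations; lia.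
    + intros a b Ha Hb. rewrite !HW by assumption.
      assert (Hin : In (val_constraint p s chi a b) (constraints p s chi)).
      { apply in_constraints. exists a, b. auto. }
      unfold val_constraint in Hin.
      destruct (Nat.ltb_spec (nth a p 0%nat) (nth b p 0%nat)); apply Hs in Hin;
        rewrite Hval in Hin by assumption; split; intros; try lia;
        Z.to_euclidean_division_equations; lia.
  - intros [Hpos Hv] i j f Hin. apply in_constraints in Hin as (a & b & Ha & Hb & [E|Hin]).
    + specialize (Hv a b Ha Hb). rewrite !HW in Hv by assumption.
      unfold val_constraint in E.
      destruct (Nat.ltb_spec (nth a p 0%nat) (nth b p 0%nat));
        injection E as -> -> ->; rewrite Hval by assumption.
      * assert (H1 := proj2 Hv H). Z.to_euclidean_division_equations; lia.
      * assert (H1 := fun h => proj1 Hv h). apply Nat.le_ngt in H.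
        assert (H2 : ~ 3 * x a + 3 * mcoord q (col chi a) + scoord s (col chi a) <
          3 * x b + 3 * mcoord q (col chi b) + scoord s (col chi b)) by tauto.
        clear Hv H1. Z.to_euclidean_division_equations; lia.
    + unfold pos_constraint in Hin. destruct (Nat.ltb_spec a b); [|destruct Hin].
      destruct Hin as [E|[]]. injection E as <- <- <-.
      specialize (Hpos a b ltac:(lia)). unfold idx in Hpos. unfold ev, lin. cbn [fst snd].
      Z.to_euclidean_division_equations; lia.
Qed.

Lemma nth_map_seq {T} (f : nat -> T) (d : T) k a :
  (a < k)%nat -> nth a (map f (seq 0 k)) d = f a.
Proof.
  intros H. rewrite (nth_indep _ d (f O)) by (rewrite length_map, length_seq; lia).
  rewrite map_nth, seq_nth by lia. reflexivity.
Qed.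

Lemma contains_W3 p s q : contains (W3 s q) p <->
  exists chi, In chi (colorings (length p)) /\ exists x, sat (constraints p s chi) x q.
Proof.
  split.
  - intros (idx & Hl & Hpos & Hv).
    set (chi := map (fun a => (nth a idx 0 - 1) mod 3) (seq 0 (length p))).
    assert (Hchi : forall a, (a < length p)%nat -> col chi a = (nth a idx 0 - 1) mod 3).
    { intros a Ha. exact (nth_map_seq (fun a => (nth a idx 0 - 1) mod 3) 0 _ a Ha). }
    exists chi. split.
    + apply in_colorings. unfold chi. rewrite length_map, length_seq. split; [reflexivity|].
      apply Forall_forall. intros r Hr. apply in_map_iff in Hr as (a & <- & _).
      apply Z.mod_pos_bound. lia.
    + exists (fun a => (nth a idx 0 - 1) / 3).
      assert (Hidx : forall a, (a < length p)%nat ->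
        3 * ((nth a idx 0 - 1) / 3) + col chi a + 1 = nth a idx 0).
      { intros a Ha. rewrite Hchi by assumption. Z.to_euclidean_division_equations; lia. }
      apply sat_constraints.
      * intros a Ha. rewrite Hchi by assumption. apply Z.mod_pos_bound. lia.
      * split.
        -- intros a b Hab. rewrite !Hidx by lia. auto.
        -- intros a b Ha Hb. rewrite !Hidx by lia. auto.
  - intros (chi & Hchi & x & Hx). apply in_colorings in Hchi as [Hl Hf].
    rewrite Forall_forall in Hf.
    apply sat_constraints in Hx as [Hpos Hv];
      [|intros a Ha; apply Hf, nth_In; congruence].
    exists (map (fun a => 3 * x a + col chi a + 1) (seq 0 (length p))).
    split; [rewrite length_map, length_seq; reflexivity|]. split.
    + intros a b Hab. rewrite !nth_map_seq by lia. auto.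
    + intros a b Ha Hb. rewrite !nth_map_seq by lia. auto.
Qed.

(** Containment is a finite disjunction over colorings, each disjunct being handled by
    elimination. *)
Lemma determined_avoids_W3 p s : determined (fun q => avoids (W3 s q) p).
Proof.
  apply determined_not.
  apply (determined_ext (fun q => exists chi, In chi (colorings (length p)) /\
    exists x, sat (constraints p s chi) x q)).
  - intros q. symmetry. apply contains_W3.
  - apply determined_exists_in. intros chi. apply (determined_sat (length p)).
    intros i j f Hin. apply in_constraints in Hin as (a & b & Ha & Hb & [E|Hin]).
    + unfold val_constraint in E. destruct (_ <? _)%nat; injection E as -> -> _; auto.
    + unfold pos_constraint in Hin. destruct (_ <? _)%nat; [|destruct Hin].
      destruct Hin as [E|[]]. injection E as <- <- _. auto.
Qed.

(** * Parametrization of size 3 and periodicity from thin classes *)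

Lemma W3_window_entries s q :
  W3 s q 1 = 3 * fst q + fst (fst s) /\ W3 s q 2 = 3 * snd q + snd (fst s) /\
  W3 s q 3 = 3 * (- fst q - snd q) + snd s.
Proof.
  assert (H1 := W3_at s q 0 0 ltac:(lia)).
  assert (H2 := W3_at s q 0 1 ltac:(lia)).
  assert (H3 := W3_at s q 0 2 ltac:(lia)).
  change (3 * 0 + 0 + 1) with 1 in H1; change (3 * 0 + 1 + 1) with 2 in H2;
    change (3 * 0 + 2 + 1) with 3 in H3.
  rewrite H1, H2, H3. auto.
Qed.

Lemma affine_perm_W3 s q : In s residues3 -> affine_perm 3 (W3 s q).
Proof.
  intros Hs. destruct q as [u v].
  assert (Hdec : forall x, exists y c, x = 3 * y + c + 1 /\ (c = 0 \/ c = 1 \/ c = 2)).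
  { intros x. exists ((x - 1) / 3), ((x - 1) mod 3).
    Z.to_euclidean_division_equations; lia. }
  repeat split.
  - intros x x' E. destruct (Hdec x) as (y & c & -> & Hc).
    destruct (Hdec x') as (y' & c' & -> & Hc'). rewrite !W3_at in E by lia.
    unfold mcoord, scoord, pick in E.
    destruct Hs as [<-|[<-|[<-|[<-|[<-|[<-|[]]]]]]];
      destruct Hc as [->|[->| ->]], Hc' as [->|[->| ->]]; cbn -[Z.mul Z.add] in E; lia.
  - intros y.
    (* The entries of [s] represent all residues modulo 3, so one class takes values congruent to
       [y]. *)
    assert (Hc : exists c, (c = 0 \/ c = 1 \/ c = 2) /\ (y - scoord s c) mod 3 = 0).
    { destruct (Hdec y) as (z & r & -> & Hr). unfold scoord, pick.
      destruct Hs as [<-|[<-|[<-|[<-|[<-|[<-|[]]]]]]];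
        destruct Hr as [->|[->| ->]]; cbn [fst snd];
        first [exists 0; split; [auto|]; cbn -[Z.mul Z.add Z.sub Z.modulo];
                 Z.to_euclidean_division_equations; lia
              |exists 1; split; [auto|]; cbn -[Z.mul Z.add Z.sub Z.modulo];
                 Z.to_euclidean_division_equations; lia
              |exists 2; split; [auto|]; cbn -[Z.mul Z.add Z.sub Z.modulo];
                 Z.to_euclidean_division_equations; lia]. }
    destruct Hc as (c & Hc & Hm).
    exists (3 * ((y - scoord s c) / 3 - mcoord (u, v) c) + c + 1).
    rewrite W3_at by lia. Z.to_euclidean_division_equations; lia.
  - intros x. destruct (Hdec x) as (y & c & -> & Hc).
    change (Z.of_nat 3) with 3.
    replace (3 * y + c + 1 + 3) with (3 * (y + 1) + c + 1) by lia.
    rewrite !W3_at by lia. lia.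
  - cbn [seq map fold_right].
    destruct (W3_window_entries s (u, v)) as (H1 & H2 & H3).
    change (Z.of_nat 1) with 1; change (Z.of_nat 2) with 2; change (Z.of_nat 3) with 3.
    rewrite H1, H2, H3. change (3 * (3 + 1) / 2) with 6.
    destruct Hs as [<-|[<-|[<-|[<-|[<-|[<-|[]]]]]]]; cbn [fst snd]; lia.
Qed.

Definition win3 (s : Z * Z * Z) (q : Z * Z) : list Z :=
  [3 * fst q + fst (fst s); 3 * snd q + snd (fst s); 3 * (- fst q - snd q) + snd s].

Lemma win3_eq s q s' q' : win3 s q = win3 s' q' ->
  3 * fst q + fst (fst s) = 3 * fst q' + fst (fst s') /\
  3 * snd q + snd (fst s) = 3 * snd q' + snd (fst s') /\
  3 * (- fst q - snd q) + snd s = 3 * (- fst q' - snd q') + snd s'.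
Proof.
  intros E. split; [|split].
  - exact (f_equal (fun l => nth 0 l 0) E).
  - exact (f_equal (fun l => nth 1 l 0) E).
  - exact (f_equal (fun l => nth 2 l 0) E).
Qed.

Lemma window_W3 s q : window 3 (W3 s q) = win3 s q.
Proof.
  destruct (W3_window_entries s q) as (H1 & H2 & H3).
  unfold window, win3. cbn [seq map].
  change (Z.of_nat 1) with 1; change (Z.of_nat 2) with 2; change (Z.of_nat 3) with 3.
  congruence.
Qed.

Lemma affine_perm_3_W3 w : affine_perm 3 w ->
  exists s q, In s residues3 /\ forall x, w x = W3 s q x.
Proof.
  intros Hw. pose proof Hw as (_ & _ & Hp & Hsum).
  assert (N12 := fun k => affine_nondiv 3 w 1 2 k Hw ltac:(lia)).
  assert (N13 := fun k => affine_nondiv 3 w 1 3 k Hw ltac:(lia)).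
  assert (N23 := fun k => affine_nondiv 3 w 2 3 k Hw ltac:(lia)).
  cbn [seq map fold_right] in Hsum.
  change (Z.of_nat 1) with 1 in *; change (Z.of_nat 2) with 2 in *;
    change (Z.of_nat 3) with 3 in *.
  change (3 * (3 + 1) / 2) with 6 in Hsum.
  assert (Hdec : forall z, exists m r, z = 3 * m + r /\ (r = 1 \/ r = 2 \/ r = 3)).
  { intros z. exists ((z - 1) / 3), ((z - 1) mod 3 + 1).
    Z.to_euclidean_division_equations; lia. }
  destruct (Hdec (w 1)) as (m1 & r1 & E1 & Hr1).
  destruct (Hdec (w 2)) as (m2 & r2 & E2 & Hr2).
  destruct (Hdec (w 3)) as (m3 & r3 & E3 & Hr3).
  (* These instances say that [r1], [r2], [r3] are distinct; the window sum then forces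
     [m3 = - m1 - m2]. *)
  specialize (N12 (m2 - m1)). specialize (N13 (m3 - m1)). specialize (N23 (m3 - m2)).
  exists (r1, r2, r3), (m1, m2).
  assert (Hm : m3 = - m1 - m2) by lia.
  split.
  - destruct Hr1 as [->|[->| ->]], Hr2 as [->|[->| ->]], Hr3 as [->|[->| ->]];
      try (exfalso; lia); unfold residues3; simpl; tauto.
  - intros x.
    assert (exists y c, x = 3 * y + c + 1 /\ (c = 0 \/ c = 1 \/ c = 2))
      as (y & c & -> & Hc).
    { exists ((x - 1) / 3), ((x - 1) mod 3). Z.to_euclidean_division_equations; lia. }
    rewrite W3_at by lia.
    replace (3 * y + c + 1) with (c + 1 + y * Z.of_nat 3) by lia.
    rewrite (affine_shift 3 w Hp). change (Z.of_nat 3) with 3.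
    unfold mcoord, scoord, pick. cbn [fst snd].
    destruct Hc as [->|[->| ->]]; cbn -[Z.mul Z.add Z.sub];
      [change (0 + 1) with 1|change (1 + 1) with 2|change (2 + 1) with 3]; lia.
Qed.

Definition len_form12 (s : Z * Z * Z) : form := (-1, 1, (snd (fst s) - fst (fst s)) / 3).
Definition len_form13 (s : Z * Z * Z) : form := (-2, -1, (snd s - fst (fst s)) / 3).
Definition len_form23 (s : Z * Z * Z) : form := (-1, -2, (snd s - snd (fst s)) / 3).

Lemma shi_length_W3 s q :
  shi_length 3 (W3 s q) = abs_len (len_form12 s) (len_form13 s) (len_form23 s) q.
Proof.
  destruct (W3_window_entries s q) as (H1 & H2 & H3).
  unfold shi_length, shi_inv, pairsum. cbn [sumZ].
  change (1 + Z.of_nat 0) with 1; change (1 + Z.of_nat 1) with 2;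
    change (1 + Z.of_nat 2) with 3; change (Z.of_nat 3) with 3.
  rewrite H1, H2, H3. unfold abs_len, len_form12, len_form13, len_form23, ev, lin.
  cbn [fst snd].
  destruct s as [[a b] c], q as [u v]; cbn [fst snd].
  replace ((3 * v + b - (3 * u + a)) / 3) with (-1 * u + 1 * v + (b - a) / 3)
    by (Z.to_euclidean_division_equations; lia).
  replace ((3 * (- u - v) + c - (3 * u + a)) / 3) with (-2 * u + -1 * v + (c - a) / 3)
    by (Z.to_euclidean_division_equations; lia).
  replace ((3 * (- u - v) + c - (3 * v + b)) / 3) with (-1 * u + -2 * v + (c - b) / 3)
    by (Z.to_euclidean_division_equations; lia).
  lia.
Qed.

Lemma contains_ext w w' p : (forall x, w x = w' x) -> contains w p -> contains w' p.
Proof.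
  intros H (idx & H1 & H2 & H3). exists idx. split; [assumption|]. split; [assumption|].
  intros a b Ha Hb. rewrite <- !H. auto.
Qed.

Definition avoiding_window (n : nat) (p : list nat) (i : nat) (v : list Z) : Prop :=
  exists w, affine_perm n w /\ avoids w p /\ has_length n w i /\ v = window n w.

Lemma avoiding_window_3 p i v : avoiding_window 3 p i v <->
  exists s, In s residues3 /\ exists q,
    (avoids (W3 s q) p /\
     abs_len (len_form12 s) (len_form13 s) (len_form23 s) q = Z.of_nat i) /\
    v = win3 s q.
Proof.
  split.
  - intros (w & Hw & Ha & Hl & ->).
    destruct (affine_perm_3_W3 w Hw) as (s & q & Hs & E).
    exists s. split; [assumption|]. exists q. split; [split|].
    + intros Hc. apply Ha. revert Hc. apply contains_ext. auto.
    + apply has_length_shi in Hl; [|lia|assumption].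
      rewrite <- shi_length_W3, <- Hl. symmetry. apply shi_length_ext, E.
    + rewrite <- window_W3. apply map_ext. auto.
  - intros (s & Hs & q & [Ha Hl] & ->). exists (W3 s q).
    assert (Hw := affine_perm_W3 s q Hs).
    split; [assumption|]. split; [assumption|]. split.
    + apply has_length_shi; [lia|assumption|]. rewrite shi_length_W3. assumption.
    + symmetry. apply window_W3.
Qed.

Lemma thin_periodic_3 p :
  (forall s, In s residues3 -> thin (fun q => avoids (W3 s q) p)) -> periodic p 3.
Proof.
  intros Hthin.
  assert (H : eventually_periodic (avoiding_window 3 p)).
  { apply (ep_ext (fun i v => exists s, In s residues3 /\ exists q,
      (avoids (W3 s q) p /\
       abs_len (len_form12 s) (len_form13 s) (len_form23 s) q = Z.of_nat i) /\
      v = win3 s q)).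
    { intros i v. symmetry. apply avoiding_window_3. }
    apply ep_union_list.
    (* The window modulo 3 determines the residue vector, so the six classes are disjoint. *)
    - intros s s' i v Hs Hs' (q & _ & ->) (q' & _ & E).
      destruct (win3_eq _ _ _ _ E) as (E1 & E2 & E3). clear E.
      destruct Hs as [<-|[<-|[<-|[<-|[<-|[<-|[]]]]]]];
        destruct Hs' as [<-|[<-|[<-|[<-|[<-|[<-|[]]]]]]];
        cbn [fst snd] in *; first [reflexivity|exfalso; lia].
    - intros s Hs. apply ep_image.
      + intros q q' E. destruct (win3_eq _ _ _ _ E) as (E1 & E2 & E3).
        apply pair_eq; lia.
      + apply ep_thin; [|apply determined_avoids_W3|auto].
        (* The equations [b = a] and [2 a + b = 0] already force the zero direction. *)
        intros [a b]. unfold lin, len_form12, len_form13, len_form23. cbn [fst snd].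
        intros. f_equal; lia. }
  destruct H as (N & i0 & HN & H). exists N, i0. split; [assumption|].
  intros i Hi c. destruct (H i Hi) as [d Hd].
  assert (H0 := Hd 0%nat). assert (H1 := Hd 1%nat).
  rewrite Nat.mul_0_l, Nat.add_0_r in H0. rewrite Nat.mul_1_l in H1.
  change (coeff 3 p (i + N) c) with (card_is (avoiding_window 3 p (i + N)) c).
  change (coeff 3 p i c) with (card_is (avoiding_window 3 p i) c).
  split; intros Hc.
  - rewrite (card_is_unique _ _ _ Hc H1). assumption.
  - rewrite (card_is_unique _ _ _ Hc H0). assumption.
Qed.

(** * Three-line affine permutations of size n *)

(** Each residue class of positions is translated along itself by a multiple of [n]. Since the
    classes from 2 on share [M2], the graph lies on three lines of slope one. *)
Definition Wshift (n : nat) (M0 M1 M2 : Z) (x : Z) : Z :=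
  x + Z.of_nat n * pick M0 M1 M2 ((x - 1) mod Z.of_nat n).

Lemma Wshift_residue n M0 M1 M2 x : (1 <= n)%nat ->
  (Wshift n M0 M1 M2 x - 1) mod Z.of_nat n = (x - 1) mod Z.of_nat n.
Proof.
  intros Hn. unfold Wshift. set (k := pick _ _ _ _).
  replace (x + Z.of_nat n * k - 1) with (x - 1 + k * Z.of_nat n) by lia.
  apply Z.mod_add. lia.
Qed.

Lemma Wshift_window n M0 M1 M2 (i : nat) : (i < n)%nat ->
  Wshift n M0 M1 M2 (1 + Z.of_nat i) =
  1 + Z.of_nat i + Z.of_nat n * pick M0 M1 M2 (Z.of_nat i).
Proof.
  intros Hi. unfold Wshift.
  replace (1 + Z.of_nat i - 1) with (Z.of_nat i) by lia.
  rewrite Z.mod_small by lia. reflexivity.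
Qed.

Lemma Wshift_injective n M0 M1 M2 x y : (1 <= n)%nat ->
  Wshift n M0 M1 M2 x = Wshift n M0 M1 M2 y -> x = y.
Proof.
  intros Hn E.
  assert (H : (x - 1) mod Z.of_nat n = (y - 1) mod Z.of_nat n).
  { rewrite <- (Wshift_residue n M0 M1 M2 x), E by lia. apply Wshift_residue. lia. }
  unfold Wshift in E. rewrite H in E. lia.
Qed.

Lemma pick_ge2 {T} (a b c : T) (i : nat) : pick a b c (Z.of_nat (S (S i))) = c.
Proof.
  unfold pick. destruct (Z.eqb_spec (Z.of_nat (S (S i))) 0); [lia|].
  destruct (Z.eqb_spec (Z.of_nat (S (S i))) 1); [lia|reflexivity].
Qed.

Lemma affine_perm_Wshift n M0 M1 M2 : (2 <= n)%nat ->
  M0 + M1 + (Z.of_nat n - 2) * M2 = 0 -> affine_perm n (Wshift n M0 M1 M2).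
Proof.
  intros Hn HM. apply affine_permE. split; [|split; [|split]].
  - intros x y. apply Wshift_injective. lia.
  - intros y. set (k := pick M0 M1 M2 ((y - 1) mod Z.of_nat n)).
    exists (y - Z.of_nat n * k). unfold Wshift.
    replace (y - Z.of_nat n * k - 1) with (y - 1 + (- k) * Z.of_nat n) by lia.
    rewrite Z.mod_add by lia. fold k. lia.
  - intros x. unfold Wshift.
    replace (x + Z.of_nat n - 1) with (x - 1 + 1 * Z.of_nat n) by lia.
    rewrite Z.mod_add by lia. lia.
  - unfold displ.
    rewrite (sumZ_ext _ (fun i => Z.of_nat n * pick M0 M1 M2 (Z.of_nat i)))
      by (intros i Hi; rewrite Wshift_window by lia; lia).
    destruct n as [|[|k]]; [lia|lia|]. rewrite !sumZ_head.
    rewrite (sumZ_ext _ (fun _ => Z.of_nat (S (S k)) * M2))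
      by (intros i Hi; rewrite pick_ge2; reflexivity).
    rewrite sumZ_const. change (pick M0 M1 M2 (Z.of_nat 0)) with M0.
    change (pick M0 M1 M2 (Z.of_nat 1)) with M1.
    replace (Z.of_nat (S (S k)) - 2) with (Z.of_nat k) in HM by lia.
    set (m := Z.of_nat (S (S k))).
    replace (m * M0 + (m * M1 + Z.of_nat k * (m * M2)))
      with (m * (M0 + M1 + Z.of_nat k * M2)) by ring.
    rewrite HM. lia.
Qed.

(** For [i < j] in the window, [0 < j - i < n] vanishes under the floor and leaves the difference of
    the two shifts. Pairs inside the third class contribute nothing; each of the first two classes
    pairs with it [n - 2] times. *)
Lemma shi_length_Wshift n M0 M1 M2 : (2 <= n)%nat ->
  shi_length n (Wshift n M0 M1 M2) =
  Z.abs (M1 - M0) + (Z.of_nat n - 2) * (Z.abs (M2 - M0) + Z.abs (M2 - M1)).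
Proof.
  intros Hn. unfold shi_length, shi_inv.
  rewrite (pairsum_ext _ (fun i j =>
    Z.abs (pick M0 M1 M2 (Z.of_nat j) - pick M0 M1 M2 (Z.of_nat i)))).
  - destruct n as [|[|k]]; [lia|lia|]. rewrite !pairsum_head, sumZ_head.
    rewrite (sumZ_ext _ (fun _ => Z.abs (M2 - M0)))
      by (intros i Hi; rewrite pick_ge2; reflexivity).
    rewrite (sumZ_ext (fun j => Z.abs (pick M0 M1 M2 (Z.of_nat (S (S j))) - _))
      (fun _ => Z.abs (M2 - M1)))
      by (intros i Hi; rewrite pick_ge2; reflexivity).
    rewrite (pairsum_ext _ (fun _ _ => 0))
      by (intros i j Hij; rewrite !pick_ge2; lia).
    unfold pairsum. rewrite (sumZ_ext (fun j => sumZ (fun _ => 0) j) (fun _ => 0))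
      by (intros i _; rewrite sumZ_const; lia).
    rewrite !sumZ_const. change (pick M0 M1 M2 (Z.of_nat 0)) with M0.
    change (pick M0 M1 M2 (Z.of_nat 1)) with M1.
    replace (Z.of_nat (S (S k)) - 2) with (Z.of_nat k) by lia. ring.
  - intros i j Hij. rewrite !Wshift_window by lia. f_equal.
    symmetry. apply (Z.div_unique _ _ _ (Z.of_nat j - Z.of_nat i)); [left; lia|ring].
Qed.

(* The coefficients are chosen so that [Wn_contains] can compare [Wn n q] with
   [W3 s (3 n^2 q)] exactly; the class [M2] is repeated [n - 2] times. *)
Definition Wn (n : nat) (q : Z * Z) : Z -> Z :=
  let N := Z.of_nat n in let m := - fst q - snd q in
  Wshift n (N * fst q - (N - 3) * m) (N * snd q - (N - 3) * m) (3 * m).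

Lemma affine_perm_Wn n q : (2 <= n)%nat -> affine_perm n (Wn n q).
Proof. intros Hn. apply affine_perm_Wshift; [assumption|]. ring. Qed.

Lemma shi_length_Wn n q : (2 <= n)%nat ->
  shi_length n (Wn n q) = Z.of_nat n * (Z.abs (fst q - snd q) +
    (Z.of_nat n - 2) * (Z.abs (2 * fst q + snd q) + Z.abs (fst q + 2 * snd q))).
Proof.
  intros Hn. unfold Wn. rewrite shi_length_Wshift by assumption.
  set (N := Z.of_nat n). destruct q as [u v]; cbn [fst snd].
  replace (N * v - (N - 3) * (- u - v) - (N * u - (N - 3) * (- u - v)))
    with (- (N * (u - v))) by ring.
  replace (3 * (- u - v) - (N * u - (N - 3) * (- u - v)))
    with (- (N * (2 * u + v))) by ring.
  replace (3 * (- u - v) - (N * v - (N - 3) * (- u - v)))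
    with (- (N * (u + 2 * v))) by ring.
  rewrite !Z.abs_opp, !Z.abs_mul, (Z.abs_eq N) by (unfold N; lia). ring.
Qed.

(* The map [x |-> 9 x + r + 1], with [r] the class of [x], embeds the graph of
   [Wn n q] into that of [W3 s (3 n^2 q)], preserving both orders. *)
Lemma Wn_contains n s q p : (1 <= n)%nat -> In s residues3 ->
  contains (Wn n q) p -> contains (W3 s (smul (3 * (Z.of_nat n * Z.of_nat n)) q)) p.
Proof.
  intros Hn Hs (idx & Hl & Hpos & Hv).
  set (N := Z.of_nat n) in *. set (Q := smul (3 * (N * N)) q).
  set (cl := fun x => pick 0 1 2 ((x - 1) mod N)).
  set (phi := fun x => 3 * (3 * x) + cl x + 1).
  assert (Hcl : forall x, cl x = 0 \/ cl x = 1 \/ cl x = 2).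
  { intros x. unfold cl, pick. destruct (_ =? 0); [auto|]. destruct (_ =? 1); auto. }
  assert (Hsc : forall c, 1 <= scoord s c <= 3).
  { intros c. unfold scoord, pick.
    destruct Hs as [<-|[<-|[<-|[<-|[<-|[<-|[]]]]]]]; cbn [fst snd];
      destruct (_ =? 0); try lia; destruct (_ =? 1); lia. }
  (* [K] is the same for all three classes, so it does not affect the order of values. *)
  set (K := 9 * N * (N - 3) * (- fst q - snd q)).
  assert (HW : forall x, W3 s Q (phi x) = 9 * Wn n q x + K + scoord s (cl x)).
  { intros x. unfold phi. rewrite W3_at by (specialize (Hcl x); lia).
    unfold Wn, Wshift. fold N. unfold mcoord, K.
    assert (Hp : forall {T} (a b c : T), pick a b c (cl x) = pick a b c ((x - 1) mod N)).
    { intros T a b c. unfold cl, pick.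
      destruct ((x - 1) mod N =? 0); [reflexivity|].
      destruct ((x - 1) mod N =? 1); reflexivity. }
    rewrite Hp. unfold Q, smul; cbn [fst snd]. unfold pick.
    destruct ((x - 1) mod N =? 0); [ring|]. destruct ((x - 1) mod N =? 1); ring. }
  exists (map phi idx).
  assert (Hnth : forall a, (a < length p)%nat -> nth a (map phi idx) 0 = phi (nth a idx 0)).
  { intros a Ha. rewrite (nth_indep _ 0 (phi 0)) by (rewrite length_map; lia).
    apply map_nth. }
  split; [rewrite length_map; assumption|]. split.
  - intros a b Hab. rewrite !Hnth by lia. specialize (Hpos a b Hab). unfold phi.
    pose proof (Hcl (nth a idx 0)). pose proof (Hcl (nth b idx 0)). lia.
  - intros a b Ha Hb. rewrite !Hnth by lia. rewrite <- (Hv a b Ha Hb), !HW.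
    set (x := nth a idx 0). set (y := nth b idx 0).
    pose proof (Hsc (cl x)). pose proof (Hsc (cl y)).
    (* Distinct values are at least 9 apart after scaling, more than the difference of two entries
       of [s]; equal values come from equal positions. *)
    destruct (Z.eq_dec (Wn n q x) (Wn n q y)) as [E|E]; [|lia].
    assert (x = y) as -> by (revert E; apply Wshift_injective; lia). lia.
Qed.

(** * Finiteness and boundedness of the coefficients *)

Fixpoint words (n k : nat) : list (list nat) :=
  match k with
  | O => [[]]
  | S k => flat_map (fun w => map (fun j => j :: w) (seq 0 n)) (words n k)
  end.

Lemma in_words n js : Forall (fun j => (j < n)%nat) js -> In js (words n (length js)).
Proof.
  induction 1 as [|j js Hj _ IH]; [left; reflexivity|]. simpl.
  apply in_flat_map. exists js. split; [assumption|].
  apply in_map_iff. exists j. split; [reflexivity|]. apply in_seq. lia.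
Qed.

Lemma card_is_finite {X} (l : list X) (P : X -> Prop) :
  (forall x, P x -> In x l) -> exists c, card_is P c.
Proof.
  intros H.
  assert (Hf : exists l', NoDup l' /\ forall x, In x l' <-> In x l /\ P x).
  { clear H. induction l as [|x l (l' & Hd & Hl')].
    - exists []. split; [constructor|]. simpl. tauto.
    - destruct (classic (P x /\ ~ In x l')) as [[HP Hn]|Hn].
      + exists (x :: l'). split; [constructor; assumption|].
        intros y. simpl. rewrite Hl'. intuition congruence.
      + exists l'. split; [assumption|]. intros y. rewrite Hl'. simpl. split; [tauto|].
        intros [[<-|Hy] HP]; [|tauto]. rewrite <- Hl'.
        apply NNPP. tauto. }
  destruct Hf as (l' & Hd & Hl'). exists (length l'), l'. split; [assumption|].
  split; [reflexivity|]. intros x. rewrite Hl'. split; [tauto|auto].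
Qed.

(** An element of length [i] is the product of one of the finitely many words with [i] letters. *)
Lemma avoiding_window_finite n p i : exists c, card_is (avoiding_window n p i) c.
Proof.
  apply (card_is_finite (map (fun js => window n (word_fun n js)) (words n i))).
  intros v (w & _ & _ & [(js & <- & Hf & He) _] & ->).
  apply in_map_iff. exists js. split; [|apply in_words; assumption].
  apply map_ext. auto.
Qed.

(** [B] bounds the coefficients over one period from [i0]; a later coefficient is reduced to that
    range by steps of [N]. *)
Lemma periodic_bounded p n : periodic p n -> exists i0 B : nat,
  forall i, (i0 <= i)%nat -> exists c, (c <= B)%nat /\ card_is (avoiding_window n p i) c.
Proof.
  intros (N & i0 & HN & Hper).
  assert (Hfin : forall m : nat, exists B : nat, forall i, (i0 <= i < i0 + m)%nat ->
    exists c, (c <= B)%nat /\ card_is (avoiding_window n p i) c).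
  { induction m as [|m [B HB]]; [exists 0%nat; lia|].
    destruct (avoiding_window_finite n p (i0 + m)) as [d Hd]. exists (B + d)%nat.
    intros i Hi. destruct (Nat.eq_dec i (i0 + m)) as [->|].
    - exists d. split; [lia|assumption].
    - destruct (HB i ltac:(lia)) as (c & Hc & Hcard). exists c. split; [lia|assumption]. }
  destruct (Hfin N) as [B HB]. exists i0, B.
  intros i. induction i as [i IH] using lt_wf_ind. intros Hi.
  destruct (le_lt_dec (i0 + N) i) as [Hle|Hlt]; [|apply HB; lia].
  destruct (IH (i - N)%nat ltac:(lia) ltac:(lia)) as (c & Hc & Hcard).
  exists c. split; [assumption|].
  apply (Hper (i - N)%nat ltac:(lia) c) in Hcard.
  replace (i - N + N)%nat with i in Hcard by lia. exact Hcard.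
Qed.

(** * Unbounded coefficients from a fat class *)

Lemma eventually_all_below (Q : nat -> Z -> Prop) :
  (forall e, exists t0, forall t, t0 <= t -> Q e t) ->
  forall B, exists t0, forall t e, t0 <= t -> (e <= B)%nat -> Q e t.
Proof.
  intros H. induction B as [|B [t0 IH]].
  - destruct (H 0%nat) as [t0 H0]. exists t0. intros t e Ht He.
    replace e with 0%nat by lia. auto.
  - destruct (H (S B)) as [t1 H1]. exists (Z.max t0 t1). intros t e Ht He.
    destruct (Nat.eq_dec e (S B)) as [->|]; [apply H1; lia|apply IH; lia].
Qed.

(** As [x] is a nonzero integer, [t x] outweighs [y] and fixes the sign. *)
Lemma abs_perturb x y t : x <> 0 -> Z.abs y < t ->
  Z.abs (t * x + y) = Z.sgn x * (t * x + y).
Proof.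
  intros Hx Hy. destruct (Z.lt_trichotomy x 0) as [H|[H|H]]; [|lia|].
  - rewrite Z.sgn_neg by lia. assert (t * x + y <= 0) by nia. lia.
  - rewrite Z.sgn_pos by lia. assert (0 <= t * x + y) by nia. lia.
Qed.

(** The third entry, available as [n >= 3], determines [u + v]; the first two then give [u] and
    [v]. *)
Lemma window_Wn_injective n q r : (3 <= n)%nat ->
  window n (Wn n q) = window n (Wn n r) -> q = r.
Proof.
  intros Hn E. unfold window in E.
  assert (H : forall i : nat, (i < n)%nat ->
    Wn n q (1 + Z.of_nat i) = Wn n r (1 + Z.of_nat i)).
  { intros i Hi. replace (1 + Z.of_nat i) with (Z.of_nat (S i)) by lia.
    apply (ext_in_map E). apply in_seq. lia. }
  assert (H0 := H 0%nat ltac:(lia)). assert (H1 := H 1%nat ltac:(lia)).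
  assert (H2 := H 2%nat ltac:(lia)). unfold Wn in H0, H1, H2.
  rewrite !Wshift_window in H0, H1, H2 by lia.
  unfold pick in H0, H1, H2. cbn -[Z.mul Z.add Z.sub Z.opp] in H0, H1, H2.
  destruct q as [u v], r as [u' v']. cbn [fst snd] in *.
  set (N := Z.of_nat n) in *. assert (HN : 3 <= N) by (unfold N; lia).
  change (Z.of_nat 0) with 0 in *; change (Z.of_nat 1) with 1 in *;
  change (Z.of_nat 2) with 2 in *.
  assert (E2 : - u - v = - u' - v').
  { cut (N * (3 * (- u - v)) = N * (3 * (- u' - v'))); [nia|lia]. }
  rewrite E2 in H0, H1.
  assert (E0 : u = u').
  { apply (Z.mul_reg_l _ _ N); [lia|].
    apply (Z.mul_reg_l _ _ N); [lia|]. lia. }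
  f_equal; lia.
Qed.

(** The points [t q + e V] with [e <= B] all give avoiders of one common length once [t] is large,
    so some coefficient exceeds the bound [B] that periodicity would provide. *)
Lemma fat_not_periodic n p s : (3 <= n)%nat -> In s residues3 ->
  fat (fun q => avoids (W3 s q) p) -> ~ periodic p n.
Proof.
  intros Hn Hs (q & Hq1 & Hq2 & Hq3 & Hfat) Hper.
  destruct (periodic_bounded p n Hper) as (i0 & B & HB).
  set (N := Z.of_nat n).
  set (s1 := Z.sgn (fst q - snd q)). set (s2 := Z.sgn (2 * fst q + snd q)).
  set (s3 := Z.sgn (fst q + 2 * snd q)).
  (* [al] and [be] collect the coefficients of [u] and [v] when each absolute value in
     [shi_length_Wn] is replaced by its form with the sign taken at [q]. *)
  set (al := s1 + (N - 2) * (2 * s2 + s3)).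
  set (be := - s1 + (N - 2) * (s2 + 2 * s3)).
  (* On the chamber of [q] the length of [Wn n] is [n (al u + be v)]; [V] spans its kernel. *)
  set (V := (be, - al)).
  set (L := al * fst q + be * snd q).
  (* [L] is the weighted sum of the absolute values at [q], whose first term is positive since [q]
     is off the wall [u = v]. *)
  assert (HL : 0 < L).
  { replace L with (s1 * (fst q - snd q) +
      (N - 2) * (s2 * (2 * fst q + snd q) + s3 * (fst q + 2 * snd q)))
      by (unfold L, al, be; ring).
    unfold s1, s2, s3.
    assert (Hsgn : forall x, Z.sgn x * x = Z.abs x) by lia. rewrite !Hsgn.
    assert (0 <= (N - 2) * (Z.abs (2 * fst q + snd q) + Z.abs (fst q + 2 * snd q)))
      by (apply Z.mul_nonneg_nonneg; unfold N; lia). lia. }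
  set (pt := fun (e : nat) t => vadd (smul t q) (smul (Z.of_nat e) V)).
  assert (Hlen : forall e, exists t0, forall t, t0 <= t ->
    shi_length n (Wn n (pt e t)) = N * (t * L)).
  { intros e. destruct (exists_upper_bound [(1, -1, 0); (2, 1, 0); (1, 2, 0)]
      (fun f : form => Z.abs (lin f (smul (Z.of_nat e) V)))) as (b & _ & Hb).
    exists (b + 1). intros t Ht. rewrite shi_length_Wn by lia. fold N.
    assert (B1 := Hb _ (or_introl eq_refl)).
    assert (B2 := Hb _ (or_intror (or_introl eq_refl))).
    assert (B3 := Hb _ (or_intror (or_intror (or_introl eq_refl)))).
    cbv beta in B1, B2, B3. unfold lin in B1, B2, B3. cbn [fst snd] in B1, B2, B3.
    set (r := smul (Z.of_nat e) V) in *.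
    assert (Hbt : b < t) by lia.
    assert (Hq1' : fst q - snd q <> 0) by lia.
    assert (E1 := abs_perturb (fst q - snd q) (1 * fst r + -1 * snd r) t
      Hq1' (Z.le_lt_trans _ _ _ B1 Hbt)).
    assert (E2 := abs_perturb (2 * fst q + snd q) (2 * fst r + 1 * snd r) t
      Hq2 (Z.le_lt_trans _ _ _ B2 Hbt)).
    assert (E3 := abs_perturb (fst q + 2 * snd q) (1 * fst r + 2 * snd r) t
      Hq3 (Z.le_lt_trans _ _ _ B3 Hbt)).
    fold s1 in E1. fold s2 in E2. fold s3 in E3.
    unfold pt. fold r. unfold vadd, smul; cbn [fst snd].
    replace (t * fst q + fst r - (t * snd q + snd r))
      with (t * (fst q - snd q) + (1 * fst r + -1 * snd r)) by ring.
    replace (2 * (t * fst q + fst r) + (t * snd q + snd r))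
      with (t * (2 * fst q + snd q) + (2 * fst r + 1 * snd r)) by ring.
    replace (t * fst q + fst r + 2 * (t * snd q + snd r))
      with (t * (fst q + 2 * snd q) + (1 * fst r + 2 * snd r)) by ring.
    rewrite E1, E2, E3.
    unfold r, smul, V; cbn [fst snd]. unfold L, al, be. ring. }
  assert (Hav : forall e, exists t0, forall t, t0 <= t -> avoids (Wn n (pt e t)) p).
  { intros e. destruct (Hfat (smul (Z.of_nat e) V)) as [t0 Ht0]. exists t0.
    intros t Ht Hc.
    (* The scaling factor [s] in [fat] is there to absorb the [3 n^2] of [Wn_contains]. *)
    apply (Ht0 t (3 * (Z.of_nat n * Z.of_nat n)) Ht ltac:(nia)).
    apply Wn_contains; [lia|assumption|exact Hc]. }
  destruct (eventually_all_below _ Hlen B) as [t1 Ht1].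
  destruct (eventually_all_below _ Hav B) as [t2 Ht2].
  (* Beyond both thresholds, and large enough for the common length [N t L] to lie in the bounded
     range from [i0] on. *)
  set (t := Z.max 0 (Z.max (Z.max t1 t2) (Z.of_nat i0))).
  assert (HtL : Z.of_nat i0 <= N * (t * L)).
  { assert (t <= t * L) by (unfold t in *; nia).
    assert (t * L <= N * (t * L)) by (unfold N in *; nia).
    assert (Z.of_nat i0 <= t) by (unfold t; lia). lia. }
  destruct (HB (Z.to_nat (N * (t * L))) ltac:(lia)) as (c & Hc & Hcard).
  assert (Hle := card_is_le _ _
    (map (fun e => window n (Wn n (pt e t))) (seq 0 (S B))) Hcard).
  rewrite length_map, length_seq in Hle.
  cut (S B <= c)%nat; [lia|]. apply Hle.
  - apply FinFun.Injective_map_NoDup; [|apply seq_NoDup].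
    intros e e' E. apply window_Wn_injective in E; [|assumption].
    pose proof (f_equal fst E) as E1. pose proof (f_equal snd E) as E2.
    unfold pt, vadd, smul, V in E1, E2. cbn [fst snd] in E1, E2.
    assert (F1 : (Z.of_nat e - Z.of_nat e') * be = 0) by lia.
    assert (F2 : (Z.of_nat e - Z.of_nat e') * al = 0) by lia.
    apply Z.mul_eq_0 in F1 as [F1|F1]; [lia|]. apply Z.mul_eq_0 in F2 as [F2|F2]; [lia|].
    (* Two equal points with different [e] would make [V] zero, hence [L = 0]. *)
    unfold L in HL. rewrite F1, F2 in HL. lia.
  - intros v Hv. apply in_map_iff in Hv as (e & <- & He). apply in_seq in He.
    exists (Wn n (pt e t)). split; [apply affine_perm_Wn; lia|].
    split; [apply Ht2; unfold t; lia|]. split; [|reflexivity].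
    apply has_length_shi; [lia|apply affine_perm_Wn; lia|].
    rewrite Ht1 by (unfold t; lia). lia.
Qed.

Theorem mainTheorem14 (n : nat) (p : list nat) :
  (3 < n)%nat -> is_perm_pattern p -> ~ periodic p 3 -> ~ periodic p n.
Proof.
  intros Hn _ H3.
  assert (exists s, In s residues3 /\ fat (fun q => avoids (W3 s q) p)) as (s & Hs & Hfat).
  { apply NNPP. intros Hno. apply H3, thin_periodic_3. intros s Hs.
    destruct (determined_thin_or_fat _ (determined_avoids_W3 p s)); [assumption|].
    exfalso. eauto. }
  apply (fat_not_periodic n p s); [lia|assumption|assumption].
Qed.
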